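(* Let $(M,\{\omega^i\}_{i=1}^3,\theta=\omega^1)$ be a homogeneous contact manifold whose Lie algebra is isomorphic to $\mathfrak{su}(2)$, with the coframe $\{\omega^i\}$ adapted in the sense of the context. Then there is a unique homogeneous complex structure $J_{a_\infty,b=1,c_\infty}$ for which the pseudohermitian manifold $(M,\theta,J_{a_\infty,b=1,c_\infty})$ is torsion free. Moreover, for any choice of homogeneous complex structure $J_{a,b=1,c}$ (with $a\in\mathbb{R}$, $c>0$), the normalized torsion flow starting at $(\theta,J_{a,b=1,c})$ converges to this unique CR structure $(\ker\theta,J_{a_\infty,b=1,c_\infty})$. In particular, for any choice of homogeneous complex structure on $SU(2)$, the normalized torsion flow converges to the standard CR structure.
   Context: Pseudohermitian notions. A pseudohermitian 3-manifold $(M,J,\theta)$ is a 3-manifold with a contact form $\theta$, $\xi=\ker\theta$, Reeb field $T$ ($\theta(T)=1$, $d\theta(T,\cdot)=0$), and an endomorphism $J:\xi\to\xi$, $J^2=-\mathrm{Id}$, with $d\theta(\cdot,J\cdot)$ positive definite. Let $Z_1$ be a local frame of the $(+i)$-eigenbundle $T^{1,0}\subset\xi\otimes\mathbb{C}$, $Z_{\bar 1}=\overline{Z_1}$, with coframe $\{\theta,\theta^1,\theta^{\bar 1}\}$ dual to $\{T,Z_1,Z_{\bar 1}\}$, normalized so that $d\theta=i\theta^1\wedge\theta^{\bar 1}$. The Tanaka-Webster connection form $\omega_1{}^1$ and torsion are determined by $d\theta^1=\theta^1\wedge\omega_1{}^1+A^1{}_{\bar 1}\,\theta\wedge\theta^{\bar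 1}$ with $\omega_1{}^1$ purely imaginary; $A_{\bar 1\bar 1}=A^1{}_{\bar 1}$, $A_{11}=\overline{A_{\bar 1\bar 1}}$. The torsion tensor is $A_{J,\theta}=A_{11}\,\theta^1\otimes Z_{\bar 1}+A_{\bar 1\bar 1}\,\theta^{\bar 1}\otimes Z_1$; torsion free means $A_{J,\theta}=0$. The Webster curvature $W$ is defined by $d\omega_1{}^1\equiv W\theta^1\wedge\theta^{\bar 1}$ mod $\theta$. Normalized torsion flow: $\partial_tJ_{(t)}=2A_{J_{(t)},\theta_{(t)}}$, $\partial_t\theta_{(t)}=-2(W-\bar W)\theta_{(t)}$, where $\bar W=\int_M W\,\theta\wedge d\theta/\int_M\theta\wedge d\theta$. Homogeneous contact manifold: a 3-manifold $M$ with global 1-forms $\omega^1,\omega^2,\omega^3$ forming a basis of $T^*M$ at each point, with $d\omega^i=\sum_{j<k}c^i_{jk}\,\omega^j\wedge\omega^k$, $c^i_{jk}$ constant, and a contact form $\theta=\sum_ic_i\omega^i$ with constants $c_i$. Its Lie algebra is the one with structure constants given by the dual frame: $[X_j,X_k]=-\sum_ic^i_{jk}X_i$. The coframe is adapted: $\theta=\omega^1$, $c^1_{23}=1$ and $c^1_{12}=c^1_{13}=c^2_{12}=c^3_{13}=0$ (every homogeneous contact manifold admits such a coframe). Then $X_1$ is the Reeb field and $X_2,X_3$ span $\xi=\ker\theta$. Homogeneous complex structure: for constants $a\in\mathbb{R}$, $b,c>0$, $$J_{abc}=aX_2\otimes\omega^2+cX_3\otimes\omega^2-\tfrac{1+a^2}{c}X_2\otimes\omega^3-aX_3\otimes\omega^3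 ,$$ on $\xi$ (the parameter $b$ refers to the contact form $b^2\theta$; here $b=1$). For such structures $W$ is constant in space, so in the normalized flow $\theta$ stays fixed and the flow is a flow $J_{a_t,1,c_t}$ of homogeneous complex structures; convergence means $(a_t,c_t)\to(a_\infty,c_\infty)$ as $t\to\infty$. The standard CR structure on $SU(2)=S^3\subset\mathbb{C}^2$ is the one given by complex tangencies of the unit sphere. *)

(* Defs.v *)
From HB Require Import structures.
From mathcomp Require Import all_boot all_order all_algebra.
From mathcomp Require Import all_classical all_reals all_analysis.
From mathcomp Require Import complex.

Set Implicit Arguments.
Unset Strict Implicit.
Unset Printing Implicit Defensive.

Import Order.TTheory GRing.Theory Num.Theory.
Import numFieldNormedType.Exports.

Local Open Scope classical_set_scope.
Local Open Scope ring_scope.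
Local Open Scope complex_scope.

(* The indices 1, 2, 3 of the text. *)
Definition i1 : 'I_3 := @Ordinal 3 0 isT.
Definition i2 : 'I_3 := @Ordinal 3 1 isT.
Definition i3 : 'I_3 := @Ordinal 3 2 isT.

Section Manifold.
Variable R : realType.

(* [f] is of class C^n on the open set [U] of R^3. *)
Fixpoint Ck (n : nat) (U : set 'rV[R]_3) (f : 'rV[R]_3 -> R) : Prop :=
  (forall x, U x -> {for x, continuous f}) /\
  match n with
  | 0%N => True
  | m.+1 => forall i : 'I_3,
      (forall x, U x -> derivable f x (delta_mx 0 i)) /\
      Ck m U (fun x => 'D_(delta_mx 0 i) f x)
  end.

Definition smooth_on (U : set 'rV[R]_3) (f : 'rV[R]_3 -> R) : Prop :=
  forall n, Ck n U f.

Record chart (M : topologicalType) := Chart {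
  chart_dom : set M;
  chart_cod : set 'rV[R]_3;
  chart_map : M -> 'rV[R]_3;
  chart_inv : 'rV[R]_3 -> M;
  chart_dom_open : open chart_dom;
  chart_cod_open : open chart_cod;
  chart_mapP : forall p, chart_dom p -> chart_cod (chart_map p);
  chart_invP : forall x, chart_cod x -> chart_dom (chart_inv x);
  chart_mapK : forall p, chart_dom p -> chart_inv (chart_map p) = p;
  chart_invK : forall x, chart_cod x -> chart_map (chart_inv x) = x;
  chart_map_cont : forall p, chart_dom p -> {for p, continuous chart_map};
  chart_inv_cont : forall x, chart_cod x -> {for x, continuous chart_inv}
}.

Record manifold3 := Manifold3 {
  points :> topologicalType;
  points_inhabited : exists p : points, True;
  points_hausdorff : hausdorff_space points;
  points_second_countable : @second_countable points;
  atlas : set (chart points);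
  atlas_cover : forall p, exists2 k, atlas k & chart_dom k p;
  atlas_compatible : forall k l, atlas k -> atlas l -> forall i : 'I_3,
    smooth_on [set x | chart_cod k x /\ chart_dom l (chart_inv k x)]
              (fun x => chart_map l (chart_inv k x) 0 i)
}.

Definition smooth (M : manifold3) (f : M -> R) : Prop :=
  forall k, atlas k -> smooth_on (chart_cod k) (f \o chart_inv k).

Definition csmooth (M : manifold3) (f : M -> R[i]) : Prop :=
  smooth (fun p => complex.Re (f p)) /\ smooth (fun p => complex.Im (f p)).

(* Smooth vector fields, as derivations of the algebra of smooth functions.
   The values on functions that are not smooth are irrelevant. *)
Record derivation (M : manifold3) (X : (M -> R) -> M -> R) : Prop := Derivation {
  derivation_smooth : forall f, smooth f -> smooth (X f);
  derivation_lin : forall (k : R) f g, smooth f -> smooth g ->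
    X (fun p => k * f p + g p) = (fun p => k * X f p + X g p);
  derivation_leibniz : forall f g, smooth f -> smooth g ->
    X (fun p => f p * g p) = (fun p => X f p * g p + f p * X g p)
}.

(* A 3-manifold with a global coframe w^1, w^2, w^3 with
   d w^i = sum_(j < k) c^i_jk w^j /\ w^k, [c^i_jk] being [str_const i j k].
   It is recorded through the dual frame X_1, X_2, X_3, for which the structure
   equations read [X_j, X_k] = - sum_i c^i_jk X_i.  The constants, given for
   j < k in the text, are extended to an array antisymmetric in j, k. *)
Record homogeneous_manifold := HomogeneousManifold {
  carrier :> manifold3;
  frame : 'I_3 -> (carrier -> R) -> carrier -> R;
  str_const : 'I_3 -> 'I_3 -> 'I_3 -> R;
  frame_derivation : forall i, derivation (frame i);
  frame_free : forall (p : carrier) (u : 'I_3 -> R),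
    (forall f, smooth f -> \sum_i u i * frame i f p = 0) -> forall i, u i = 0;
  str_const_anti : forall i j k, str_const i k j = - str_const i j k;
  frame_bracket : forall j k f p, smooth f ->
    frame j (frame k f) p - frame k (frame j f) p
      = - \sum_i str_const i j k * frame i f p
}.

(* With c^1_23 = 1 the form w^1 is a contact form, since
   w^1 /\ d w^1 = w^1 /\ w^2 /\ w^3. *)
Definition adapted (M : homogeneous_manifold) : Prop :=
  let c := @str_const M in
  [/\ c i1 i2 i3 = 1,
      c i1 i1 i2 = 0 /\ c i1 i1 i3 = 0,
      c i2 i1 i2 = 0
    & c i3 i1 i3 = 0].

End Manifold.

Section SU2.
Variable R : realType.

Definition adjoint_mx (g : 'M[R[i]]_2) : 'M[R[i]]_2 := (map_mx (@conjc R) g)^T.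

Definition SU2 (g : 'M[R[i]]_2) : Prop := g *m adjoint_mx g = 1%:M /\ \det g = 1.

Definition su2 (x : 'M[R[i]]_2) : Prop := adjoint_mx x = - x /\ \tr x = 0.

(* The Lie algebra R^3 with basis X_1, X_2, X_3. *)
Definition lie_bracket (M : homogeneous_manifold R) (u v : 'rV[R]_3) : 'rV[R]_3 :=
  \row_i - \sum_j \sum_k str_const M i j k * u 0 j * v 0 k.

Definition lie_algebra_iso_su2 (M : homogeneous_manifold R) : Prop :=
  exists Phi : 'rV[R]_3 -> 'M[R[i]]_2,
    [/\ forall (k : R) u v, Phi (k *: u + v) = k%:C *: Phi u + Phi v,
        injective Phi,
        range Phi = [set x | su2 x]
      & forall u v,
          Phi (lie_bracket M u v) = Phi u *m Phi v - Phi v *m Phi u].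

End SU2.

Section Pseudohermitian.
Variables (R : realType) (M : homogeneous_manifold R).

(* A complex 1-form is given by its components with respect to (w^i), a complex
   vector field by its components with respect to (X_i). *)
Definition cform1 := 'I_3 -> M -> R[i].
Definition cfield := 'I_3 -> M -> R[i].

(* A complex 2-form is given by its values on the pairs (X_j, X_k). *)
Definition cform2 := 'I_3 -> 'I_3 -> M -> R[i].

Definition conj_comp (v : 'I_3 -> M -> R[i]) : 'I_3 -> M -> R[i] :=
  fun i p => (v i p)^*%C.

Definition cpart (i : 'I_3) (f : M -> R[i]) (p : M) : R[i] :=
  frame i (fun q => complex.Re (f q)) p +i* frame i (fun q => complex.Im (f q)) p.

Definition pairing (al : cform1) (v : cfield) (p : M) : R[i] :=
  \sum_i al i p * v i p.

Definition wedge (al be : cform1) : cform2 :=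
  fun j k p => al j p * be k p - al k p * be j p.

(* d al (X_j, X_k) = X_j (al X_k) - X_k (al X_j) - al [X_j, X_k] *)
Definition ext_d (al : cform1) : cform2 :=
  fun j k p => cpart j (al k) p - cpart k (al j) p
               + \sum_i (str_const M i j k)%:C * al i p.

(* An endomorphism field is given by matrices whose (i, j) entry is the
   coefficient of X_i (x) w^j. *)
Definition apply_end (J : M -> 'M[R]_3) (v : cfield) : cfield :=
  fun i p => \sum_j (J p i j)%:C * v j p.

(* [th] is the contact form, [T] its Reeb field, [Z] = Z_1 a frame of T^{1,0},
   [th1] = theta^1, [om] the connection form, [A] = A^1_{\bar 1} =
   A_{\bar 1 \bar 1} the torsion coefficient, [W] the Webster curvature. *)
Record tanaka_webster (th : 'I_3 -> M -> R) (J : M -> 'M[R]_3)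
    (T : 'I_3 -> M -> R) (Z : cfield) (th1 om : cform1)
    (A : M -> R[i]) (W : M -> R) : Prop := TanakaWebster {
  tw_th := (fun i p => (th i p)%:C) : cform1;
  tw_T := (fun i p => (T i p)%:C) : cfield;
  tw_smooth : forall i, [/\ csmooth (tw_th i), csmooth (tw_T i), csmooth (Z i),
                            csmooth (th1 i) & csmooth (om i)];
  tw_reeb : forall p, pairing tw_th tw_T p = 1;
  tw_reeb_d : forall k p, \sum_j tw_T j p * ext_d tw_th j k p = 0;
  tw_Z_xi : forall p, pairing tw_th Z p = 0;
  tw_Z_J : forall i p, apply_end J Z i p = 'i%C * Z i p;
  tw_th1_T : forall p, pairing th1 tw_T p = 0;
  tw_th1_Z : forall p, pairing th1 Z p = 1;
  tw_th1_Zbar : forall p, pairing th1 (conj_comp Z) p = 0;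
  tw_normalized : forall j k p,
    ext_d tw_th j k p = 'i%C * wedge th1 (conj_comp th1) j k p;
  tw_om_imaginary : forall i p, (om i p)^*%C = - om i p;
  tw_structure : forall j k p,
    ext_d th1 j k p
      = wedge th1 om j k p + A p * wedge tw_th (conj_comp th1) j k p;
  tw_curvature : exists be : cform1, forall j k p,
    ext_d om j k p
      = (W p)%:C * wedge th1 (conj_comp th1) j k p + wedge be tw_th j k p
}.

(* The coefficient of X_i (x) w^j in
   A_11 theta^1 (x) Z_{\bar 1} + A_{\bar 1 \bar 1} theta^{\bar 1} (x) Z_1. *)
Definition torsion_tensor (Z : cfield) (th1 : cform1) (A : M -> R[i])
    (i j : 'I_3) (p : M) : R[i] :=
  (A p)^*%C * th1 j p * conj_comp Z i p + A p * conj_comp th1 j p * Z i p.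

Definition torsion_free (th : 'I_3 -> M -> R) (J : M -> 'M[R]_3) : Prop :=
  exists T Z th1 om A W,
    tanaka_webster th J T Z th1 om A W /\
    forall i j p, torsion_tensor Z th1 A i j p = 0.

Definition omega1 : 'I_3 -> M -> R := fun i _ => (i == i1)%:R.

(* J_{a,b=1,c}: the parameter b concerns the contact form b^2 theta only. *)
Definition Jabc (a c : R) : 'M[R]_3 :=
  a *: delta_mx i2 i2 + c *: delta_mx i3 i2
  - ((1 + a ^+ 2) / c) *: delta_mx i2 i3 - a *: delta_mx i3 i3.

(* Derivative at [t] of a function on [I]; one-sided at an end point of [I]. *)
Definition has_derivative_in (I : set R) (f : R -> R) (t l : R) : Prop :=
  (f s - f t) / (s - t) @[s --> within I (t^')] --> l.

(* The normalized torsion flow (theta, J_{a_t,1,c_t}), with theta = w^1 fixed,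
   on the time interval [I].  The equation
   d/dt theta = - 2 (W - \bar W) theta for a fixed theta says that W is equal
   to its mean value \bar W, i.e. is constant on M. *)
Definition normalized_torsion_flow (I : set R) (a c : R -> R) : Prop :=
  forall t, I t -> 0 < c t /\
    exists T Z th1 om A W,
      [/\ tanaka_webster omega1 (fun=> Jabc (a t) (c t)) T Z th1 om A W,
          forall i j p, exists2 l : R,
            has_derivative_in I (fun s => Jabc (a s) (c s) i j) t l
            & l%:C = 2 * torsion_tensor Z th1 A i j p
        & exists Wbar : R, forall p, W p = Wbar].

(* M is SU(2), through [psi], with a left-invariant coframe: the frame at g is
   X_i(g) = g x_i. *)
Definition is_SU2 (psi : M -> 'M[R[i]]_2) : Prop :=
  [/\ forall j k, csmooth (fun p => psi p j k),
      injective psi,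
      range psi = [set g | SU2 g]
    & exists x : 'I_3 -> 'M[R[i]]_2,
        (forall i p j k, cpart i (fun q => psi q j k) p = (psi p *m x i) j k) /\
        (forall u : 'I_3 -> R,
           \sum_i (u i)%:C *: x i = 0 -> forall i, u i = 0)].

(* The unit sphere of C^2 and its real tangent spaces. *)
Definition S3 : set (R[i] * R[i]) :=
  [set q | q.1 * q.1^*%C + q.2 * q.2^*%C = 1].

Definition tangent_S3 (q v : R[i] * R[i]) : Prop :=
  complex.Re (v.1 * q.1^*%C + v.2 * q.2^*%C) = 0.

(* The complex tangencies T S^3 /\ i T S^3; on them the standard complex
   structure is the multiplication by i. *)
Definition complex_tangency (q v : R[i] * R[i]) : Prop :=
  tangent_S3 q v /\ tangent_S3 q ('i%C * v.1, 'i%C * v.2).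

(* The differential at [p] of F : M -> C^2, applied to sum_i u_i X_i. *)
Definition differential (F : M -> R[i] * R[i]) (p : M) (u : 'cV[R]_3)
    : R[i] * R[i] :=
  (\sum_i (u i 0)%:C * cpart i (fun q => (F q).1) p,
   \sum_i (u i 0)%:C * cpart i (fun q => (F q).2) p).

(* (ker w^1, J) is the standard CR structure of S^3, up to a diffeomorphism
   (a smooth bijective immersion between manifolds of the same dimension). *)
Definition is_standard_CR (J : 'M[R]_3) : Prop :=
  exists F : M -> R[i] * R[i],
    [/\ csmooth (fun p => (F p).1) /\ csmooth (fun p => (F p).2),
        injective F /\ range F = S3,
        forall p u, differential F p u = (0, 0) -> u = 0
      & forall p (u : 'cV[R]_3), u i1 0 = 0 ->
          let v := differential F p u in
          complex_tangency (F p) v /\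
          differential F p (J *m u) = ('i%C * v.1, 'i%C * v.2)].

End Pseudohermitian.

(* Main.v *)
(* Write X_1, X_2, X_3 for the dual frame.  The trace form of su(2) shows that the
   only non-zero constants besides c^1_23 = 1 are p = c^2_13 < 0 and
   q = c^3_12 > 0.  The projection onto T^{1,0} is P = (1 - i J) / 2, and the
   torsion tensor is, whatever the choice of Z_1,
     2 Re (q P_{i3} conj(P_{2j}) + p P_{i2} conj(P_{3j})),
   so the flow is a planar ODE.  With lambda = - p c + q (1 + a^2) / c it reads
     a' = - lambda a,  c' = 2 q - lambda c,  lambda' = - 4 p q - lambda^2,
   a Riccati equation: lambda = y' / y with y'' = - 4 p q y, and a y and
   c y + y' / (2 p) are constant.  Hence a -> 0 and c -> sqrt (- q / p).
   On SU(2), with the limit structure, X_2 + i J X_2 is represented by a nilpotent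
   matrix, and g |-> g v, with v a unit vector of its kernel, is a CR
   diffeomorphism onto the sphere. *)
Require Import Defs.
From mathcomp Require Import all_boot all_order all_algebra.
From mathcomp Require Import all_classical all_reals all_analysis.
From mathcomp Require Import complex.
From mathcomp Require Import ring lra.
Import Order.TTheory GRing.Theory Num.Theory.
Import numFieldNormedType.Exports.
Local Open Scope classical_set_scope.
Local Open Scope ring_scope.

(** * Smooth functions and derivations *)

(** Two features of the definitions shape the argument. The Tanaka-Webster data enter existentially,
    with a frame Z_1 whose phase may vary over M. So one constant frame is exhibited to show that
    the data exist, while the torsion is computed for an arbitrary frame; this makes the explicit
    ODE equivalent to the flow. At time 0 a flow on [0, tau) has only a one-sided derivative.
    Instead of integrating lambda along an unknown flow, y is fixed beforehand as the explicit
    solution of the linear equation with y(0) = 1 and y'(0) = lambda(0), and any flow is compared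
    with it by a monotonicity argument. The arithmetic-geometric mean inequality gives lambda(0) >=
    K with K^2 = - 4 p q, hence y(t) >= exp (K t). This one bound yields existence for all positive
    times, the decay of 1 / y, and the limit K of y' / y. On the sphere, the matrices x_i that
    represent the frame are not assumed to lie in su(2); this is recovered by differentiating the
    equations of SU(2). *)

(** Agreement of [h] with the combination is asked only on [U], because in the induction the
    derivative of [h] is the combination of the derivatives of [f] and [g] only where these exist.
    Openness of [U] turns it into agreement near each point. *)
Lemma Ck_lin (R : realType) (n : nat) (U : set 'rV[R]_3) (k : R) :
  open U -> forall f g h : 'rV[R]_3 -> R,
  (forall x, U x -> h x = k * f x + g x) ->
  Ck n U f -> Ck n U g -> Ck n U h.
Proof.
move=> oU; elim: n => [|n IH] f g h hE [cf Hf] [cg Hg];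
  have nU x (Ux : U x) : \near x, (k \*: f + g) x = h x by
    near=> y; rewrite hE //; near: y; apply: open_nbhs_nbhs.
all: have ch x (Ux : U x) : {for x, continuous h}
  by rewrite /prop_for /continuous_at hE //; apply: cvg_trans (near_eq_cvg (nU x Ux)) _;
     apply: cvgD; [apply: cvgZr; exact: cf | exact: cg].
  by split.
split=> //; move=> i; have [df Df] := Hf i; have [dg Dg] := Hg i.
split=> [x Ux|].
  apply: near_eq_derivable (nU x Ux) _.
  by apply: derivableD; [apply: derivableZ; apply: df|apply: dg].
apply: IH Df Dg => x Ux; rewrite -(near_eq_derive _ (nU x Ux)).
rewrite deriveD ?deriveZ //; [exact: df| |exact: dg].
by apply: derivableZ; apply: df.
Unshelve. all: by end_near. Qed.

Lemma smooth_lin (R : realType) (M : manifold3 R) (k : R) (f g : M -> R) :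
  smooth f -> smooth g -> smooth (fun p => k * f p + g p).
Proof.
move=> sf sg ch ach n; apply: (Ck_lin R n _ k _ (f \o chart_inv ch) (g \o chart_inv ch)) => //.
- exact: chart_cod_open.
- exact: sf.
- exact: sg.
Qed.

Lemma Ck_cst (R : realType) (n : nat) (U : set 'rV[R]_3) (k : R) :
  Ck n U (fun=> k).
Proof.
elim: n k => [|n IH] k; first by split=> // x _; exact: cst_continuous.
split=> [x _|i]; first exact: cst_continuous.
split=> [x _|]; first exact: derivable_cst.
have -> : (fun x : 'rV[R]_3 => 'D_(delta_mx 0 i) (fun=> k) x) = (fun=> 0 : R).
  by apply: funext => x; exact: derive_cst.
exact: IH.
Qed.

Lemma smooth_cst (R : realType) (M : manifold3 R) (k : R) :
  smooth (fun _ : M => k).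
Proof. by move=> ch _ n; exact: Ck_cst. Qed.

(** * Real and imaginary parts, sums and case analysis over small index sets *)

Lemma complex_ext (R : rcfType) (x y : R[i]) :
  complex.Re x = complex.Re y -> complex.Im x = complex.Im y -> x = y.
Proof. by case: x y => [a b] [c d] /= -> ->. Qed.

Lemma ReD (R : rcfType) (x y : R[i]) :
  complex.Re (x + y) = complex.Re x + complex.Re y.
Proof. by case: x y => [a b] [c d]. Qed.

Lemma ImD (R : rcfType) (x y : R[i]) :
  complex.Im (x + y) = complex.Im x + complex.Im y.
Proof. by case: x y => [a b] [c d]. Qed.

Lemma ReN (R : rcfType) (x : R[i]) : complex.Re (- x) = - complex.Re x.
Proof. by case: x. Qed.

Lemma ImN (R : rcfType) (x : R[i]) : complex.Im (- x) = - complex.Im x.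
Proof. by case: x. Qed.

Lemma ReM (R : rcfType) (x y : R[i]) : complex.Re (x * y) =
  complex.Re x * complex.Re y - complex.Im x * complex.Im y.
Proof. by case: x y => [a b] [c d]. Qed.

Lemma ImM (R : rcfType) (x y : R[i]) : complex.Im (x * y) =
  complex.Re x * complex.Im y + complex.Im x * complex.Re y.
Proof. by case: x y => [a b] [c d]. Qed.

Lemma ReJ (R : rcfType) (x : R[i]) : complex.Re (x^*)%C = complex.Re x.
Proof. by case: x. Qed.

Lemma ImJ (R : rcfType) (x : R[i]) : complex.Im (x^*)%C = - complex.Im x.
Proof. by case: x. Qed.

Lemma ReC (R : rcfType) (k : R) : complex.Re k%:C%C = k. Proof. by []. Qed.

Lemma ImC (R : rcfType) (k : R) : complex.Im k%:C%C = 0. Proof. by []. Qed.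

Lemma Rei (R : rcfType) : complex.Re ('i%C : R[i]) = 0. Proof. by []. Qed.

Lemma Imi (R : rcfType) : complex.Im ('i%C : R[i]) = 1. Proof. by []. Qed.

Lemma Re0 (R : rcfType) : complex.Re (0 : R[i]) = 0. Proof. by []. Qed.

Lemma Im0 (R : rcfType) : complex.Im (0 : R[i]) = 0. Proof. by []. Qed.

Lemma Re1 (R : rcfType) : complex.Re (1 : R[i]) = 1. Proof. by []. Qed.

Lemma Im1 (R : rcfType) : complex.Im (1 : R[i]) = 0. Proof. by []. Qed.

Lemma Re_mk (R : rcfType) (a b : R) : complex.Re (a +i* b)%C = a.
Proof. by []. Qed.

Lemma Im_mk (R : rcfType) (a b : R) : complex.Im (a +i* b)%C = b.
Proof. by []. Qed.

Definition ReImE := (Re_mk, Im_mk, ReD, ImD, ReN, ImN, ReM, ImM, ReJ, ImJ, ReC, ImC,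
  Rei, Imi, Re0, Im0, Re1, Im1).

Ltac cring := apply: complex_ext; rewrite ?ReImE; ring.

Lemma sum2E (V : nmodType) (F : 'I_2 -> V) : \sum_i F i = F 0 + F 1.
Proof. by rewrite !big_ord_recl big_ord0 addr0; congr (_ + F _); apply: val_inj. Qed.

Lemma sum3E (V : nmodType) (F : 'I_3 -> V) : \sum_i F i = F i1 + F i2 + F i3.
Proof.
rewrite !big_ord_recl big_ord0 addr0 addrA.
by congr (F _ + F _ + F _); apply: val_inj.
Qed.

Lemma I3P (P : 'I_3 -> Prop) : P i1 -> P i2 -> P i3 -> forall i, P i.
Proof.
move=> P1 P2 P3 [[|[|[|//]]] Hi].
- by rewrite (_ : Ordinal Hi = i1) //; apply: val_inj.
- by rewrite (_ : Ordinal Hi = i2) //; apply: val_inj.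
- by rewrite (_ : Ordinal Hi = i3) //; apply: val_inj.
Qed.

Lemma I2P (P : 'I_2 -> Prop) : P 0 -> P 1 -> forall i, P i.
Proof.
move=> P0 P1 [[|[|//]] Hi].
- by rewrite (_ : Ordinal Hi = 0) //; apply: val_inj.
- by rewrite (_ : Ordinal Hi = 1) //; apply: val_inj.
Qed.

(** * Differentiation of real and complex functions along the frame *)

Lemma frame_lin (R : realType) (M : homogeneous_manifold R) (i : 'I_3)
    (k : R) (f g : M -> R) (p : M) : smooth f -> smooth g ->
  frame i (fun q => k * f q + g q) p = k * frame i f p + frame i g p.
Proof. by move=> sf sg; rewrite (derivation_lin (frame_derivation M i)). Qed.

Lemma frame_scale (R : realType) (M : homogeneous_manifold R) (i : 'I_3)
    (k : R) (f : M -> R) (p : M) : smooth f ->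
  frame i (fun q => k * f q) p = k * frame i f p.
Proof.
move=> sf.
(* The vanishing of a derivation on constants is derived from this lemma, so the second summand
   cannot be taken to be 0. *)
rewrite (_ : (fun q => k * f q) = (fun q => (k - 1) * f q + f q)).
  by rewrite frame_lin //; ring.
by apply: funext => q; ring.
Qed.

Lemma frame_cst (R : realType) (M : homogeneous_manifold R) (i : 'I_3)
    (k : R) (p : M) : frame i (fun=> k) p = 0.
Proof.
have s1 : smooth (fun _ : M => 1 : R) by exact: smooth_cst.
have := congr1 (fun h => h p) (derivation_leibniz (frame_derivation M i) s1 s1).
rewrite /= (_ : (fun _ : M => 1 * 1) = (fun=> 1 : R)); last first.
  by apply: funext => q; rewrite mulr1.
rewrite mulr1 mul1r => H1.
rewrite (_ : (fun _ : M => k) = (fun=> k * 1)).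
  rewrite frame_scale //; have -> : frame i (fun _ : M => 1 : R) p = 0 by lra.
  by rewrite mulr0.
by apply: funext => q; rewrite mulr1.
Qed.

Lemma smooth_scale (R : realType) (M : manifold3 R) (k : R) (f : M -> R) :
  smooth f -> smooth (fun p => k * f p).
Proof.
move=> sf; rewrite (_ : (fun p => k * f p) = (fun p => (k - 1) * f p + f p)).
  exact: smooth_lin.
by apply: funext => q; ring.
Qed.

Lemma csmooth_lin (R : realType) (M : manifold3 R) (z : R[i]) (f g : M -> R[i]) :
  csmooth f -> csmooth g -> csmooth (fun p => z * f p + g p).
Proof.
move=> [sf1 sf2] [sg1 sg2]; split.
  rewrite (_ : (fun _ => _) = (fun p => complex.Re z * complex.Re (f p) +
    (- complex.Im z * complex.Im (f p) + complex.Re (g p)))).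
    by do 2! apply: smooth_lin => //.
  by apply: funext => q; rewrite !ReImE; ring.
rewrite (_ : (fun _ => _) = (fun p => complex.Re z * complex.Im (f p) +
  (complex.Im z * complex.Re (f p) + complex.Im (g p)))).
  by do 2! apply: smooth_lin => //.
by apply: funext => q; rewrite !ReImE; ring.
Qed.

Lemma csmooth_cst (R : realType) (M : manifold3 R) (z : R[i]) :
  csmooth (fun _ : M => z).
Proof. by split; exact: smooth_cst. Qed.

Lemma cpart_lin (R : realType) (M : homogeneous_manifold R) (i : 'I_3)
    (z : R[i]) (f g : M -> R[i]) (p : M) : csmooth f -> csmooth g ->
  cpart i (fun q => z * f q + g q) p = z * cpart i f p + cpart i g p.
Proof.
move=> [sf1 sf2] [sg1 sg2]; rewrite /cpart.
rewrite (_ : (fun _ => complex.Re _) = (fun p => complex.Re z * complex.Re (f p) +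
    (- complex.Im z * complex.Im (f p) + complex.Re (g p)))); last first.
  by apply: funext => q; rewrite !ReImE; ring.
rewrite (_ : (fun _ => complex.Im _) = (fun p => complex.Re z * complex.Im (f p) +
  (complex.Im z * complex.Re (f p) + complex.Im (g p)))); last first.
  by apply: funext => q; rewrite !ReImE; ring.
rewrite !frame_lin //; try exact: smooth_lin.
by cring.
Qed.

Lemma cpart_cst (R : realType) (M : homogeneous_manifold R) (i : 'I_3)
    (z : R[i]) (p : M) : cpart i (fun=> z) p = 0.
Proof. by rewrite /cpart !frame_cst. Qed.

Lemma cpart_scale (R : realType) (M : homogeneous_manifold R) (i : 'I_3)
    (z : R[i]) (f : M -> R[i]) (p : M) : csmooth f ->
  cpart i (fun q => z * f q) p = z * cpart i f p.
Proof.
move=> sf; rewrite (_ : (fun _ => _) = (fun q => z * f q + 0)).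
  rewrite (cpart_lin _ _ _ _ _ (fun=> 0)) //; last exact: csmooth_cst.
  by rewrite cpart_cst addr0.
by apply: funext => q; rewrite addr0.
Qed.

Lemma cpart_conj (R : realType) (M : homogeneous_manifold R) (i : 'I_3)
    (f : M -> R[i]) (p : M) : csmooth f ->
  cpart i (fun q => (f q)^*%C) p = (cpart i f p)^*%C.
Proof.
move=> [sf1 sf2]; rewrite /cpart.
rewrite (_ : (fun _ => complex.Re _) = (fun p => complex.Re (f p))); last first.
  by apply: funext => q; rewrite ReJ.
rewrite (_ : (fun _ => complex.Im _) = (fun p => -1 * complex.Im (f p))); last first.
  by apply: funext => q; rewrite ImJ mulN1r.
by rewrite frame_scale // mulN1r.
Qed.

(** * Structure constants *)

(** The values 0, 1, 2 stand for the indices 1, 2, 3: the constants c^1_23 = 1, c^2_13 = p, c^3_12 =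
    q and their antisymmetric counterparts. *)
Definition unimodular_const {R : realType} (p q : R) (i j k : 'I_3) : R :=
  match val i, val j, val k with
  | 0%N, 1%N, 2%N => 1 | 0%N, 2%N, 1%N => -1
  | 1%N, 0%N, 2%N => p | 1%N, 2%N, 0%N => - p
  | 2%N, 0%N, 1%N => q | 2%N, 1%N, 0%N => - q
  | _, _, _ => 0
  end.

Lemma trace_mulmx_adjoint (R : realType) (x : 'M[R[i]]_2) :
  \tr (x *m adjoint_mx x) =
    (\sum_i \sum_j (complex.Re (x i j) ^+ 2 + complex.Im (x i j) ^+ 2))%:C%C.
Proof.
rewrite /mxtrace rmorph_sum; apply: eq_bigr => i _; rewrite mxE (rmorph_sum (real_complex R)).
by apply: eq_bigr => j _; rewrite !mxE; cring.
Qed.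

Lemma su2_trace_sqr (R : realType) (x : 'M[R[i]]_2) : su2 x -> x != 0 ->
  exists2 s : R, 0 < s & \tr (x *m x) = (- s)%:C%C.
Proof.
move=> [xA _] x0.
exists (\sum_i \sum_j (complex.Re (x i j) ^+ 2 + complex.Im (x i j) ^+ 2)).
  have ge0 i j : 0 <= complex.Re (x i j) ^+ 2 + complex.Im (x i j) ^+ 2.
    by rewrite addr_ge0 ?sqr_ge0.
  have ge0s i : 0 <= \sum_j (complex.Re (x i j) ^+ 2 + complex.Im (x i j) ^+ 2).
    by apply: sumr_ge0.
  rewrite lt_def sumr_ge0 // andbT; apply: contra x0 => /eqP s0.
  apply/eqP/matrixP => i j; rewrite mxE; apply/eqP.
  have r0 : \sum_j (complex.Re (x i j) ^+ 2 + complex.Im (x i j) ^+ 2) = 0.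
    by move: i {j} isT; apply: psumr_eq0P s0 => i _.
  have : complex.Re (x i j) ^+ 2 + complex.Im (x i j) ^+ 2 = 0.
    by move: j isT; apply: psumr_eq0P r0 => j _.
  move/eqP.
  by rewrite paddr_eq0 ?sqr_ge0 // !sqrf_eq0 eq_complex.
have := trace_mulmx_adjoint R x; rewrite xA mulmxN raddfN => E.
by rewrite rmorphN /= -E opprK.
Qed.

(** The isomorphism is used only through the images of X_1, X_2, X_3; on these, trace form and
    Jacobi identity are statements about 2x2 matrices. *)
Lemma lie_algebra_basis (R : realType) (M : homogeneous_manifold R) :
  lie_algebra_iso_su2 M ->
  exists e : 'I_3 -> 'M[R[i]]_2,
    [/\ forall i, su2 (e i),
        forall u : 'I_3 -> R, \sum_i (u i)%:C%C *: e i = 0 -> forall i, u i = 0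
      & forall j k, e j *m e k - e k *m e j
          = - \sum_i (str_const M i j k)%:C%C *: e i].
Proof.
move=> [Phi [Plin Pinj Prange Pbr]].
have P0 : Phi 0 = 0.
  have := Plin (-1) 0 0; rewrite scaler0 add0r rmorphN scaleN1r => /eqP.
  by rewrite addNr => /eqP.
have PZ k u : Phi (k *: u) = k%:C%C *: Phi u.
  by rewrite -[k *: u]addr0 Plin P0 addr0.
have PD u v : Phi (u + v) = Phi u + Phi v.
  by have := Plin 1 u v; rewrite !scale1r.
have Psum (u : 'I_3 -> R) :
    Phi (\row_i u i) = \sum_i (u i)%:C%C *: Phi (delta_mx 0 i).
  rewrite (row_sum_delta (\row_i u i)) !sum3E !PD !PZ.
  by rewrite !mxE.
exists (fun i => Phi (delta_mx 0 i)); split.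
- move=> i; suff : [set x | su2 x] (Phi (delta_mx 0 i)) by [].
  by rewrite -Prange; exists (delta_mx 0 i).
- move=> u; rewrite -Psum -P0 => /Pinj /rowP u0 i.
  by have := u0 i; rewrite !mxE.
move=> j k; rewrite -Pbr -(Psum (fun i => str_const M i j k)).
have PN u : Phi (- u) = - Phi u.
  by apply/eqP; rewrite -addr_eq0 -PD addNr P0.
rewrite -PN; congr (Phi _); apply/rowP => i; rewrite !mxE.
congr (- _).
rewrite (bigD1 j) //= (bigD1 k) //= !mxE !eqxx !mulr1.
rewrite !big1 ?addr0 //.
- by move=> l lj; rewrite big1 // => m _; rewrite !mxE (negbTE lj) mulr0 mul0r.
- by move=> l lk; rewrite !mxE (negbTE lk) mulr0.
Qed.

Lemma su2_bracket (R : realType) (x y : 'M[R[i]]_2) :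
  su2 x -> su2 y -> su2 (x *m y - y *m x).
Proof.
move=> [xA _] [yA _]; split; last first.
  by rewrite raddfB /= mxtrace_mulC subrr.
rewrite /adjoint_mx raddfB /= !map_mxM linearB /= !trmx_mul.
by rewrite -!/(adjoint_mx _) xA yA !mulNmx !mulmxN !opprK opprB.
Qed.

Lemma mx2_jacobi (K : comPzRingType) (x y z : 'M[K]_2) :
  let br (a b : 'M[K]_2) := a *m b - b *m a in
  br (br y z) x + br (br z x) y + br (br x y) z = 0.
Proof.
apply/matrixP; apply: I2P; apply: I2P;
  rewrite !(mxE, sum2E); ring.
Qed.

(* With V = [X_2, X_3], invariance of the trace form gives
   tr (V V) = q tr (X_3 X_3) = - p tr (X_2 X_2), and all three traces of squares
   are negative; the Jacobi identity then kills c^2_23 and c^3_23. *)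
Lemma adapted_su2_const (R : realType) (M : homogeneous_manifold R) :
  adapted M -> lie_algebra_iso_su2 M ->
  exists p q : R, [/\ p < 0, 0 < q
    & forall i j k, str_const M i j k = unimodular_const p q i j k].
Proof.
move=> [c123 [c112 c113] c212 c313] /lie_algebra_basis[e [eS ei eB]].
have cjj i j : str_const M i j j = 0.
  by have := str_const_anti M i j j; lra.
pose p := str_const M i2 i1 i3; pose q := str_const M i3 i1 i2.
pose al := str_const M i2 i2 i3; pose be := str_const M i3 i2 i3.
have b12 : e i1 *m e i2 - e i2 *m e i1 = - (q%:C%C *: e i3).
  by rewrite eB sum3E c112 c212 !scale0r !add0r.
have b13 : e i1 *m e i3 - e i3 *m e i1 = - (p%:C%C *: e i2).
  by rewrite eB sum3E c113 c313 !scale0r [0 + _]add0r; congr (- _); exact: addr0.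
have b23 : e i2 *m e i3 - e i3 *m e i2 =
    - (e i1 + al%:C%C *: e i2 + be%:C%C *: e i3).
  by rewrite eB sum3E c123 scale1r.
pose V := e i2 *m e i3 - e i3 *m e i2.
have V0 : V != 0.
  apply/eqP => V0.
  pose u (i : 'I_3) : R := if i == i1 then 1 else if i == i2 then al else be.
  have /ei/(_ i1) : \sum_i (u i)%:C%C *: e i = 0.
    rewrite sum3E /u /= scale1r; apply/eqP; rewrite -oppr_eq0 -b23; exact/eqP.
  by rewrite /u /= => /eqP; rewrite oner_eq0.
have e0 j : e j != 0.
  apply/eqP => ej0.
  have /ei/(_ j) : \sum_i ((i == j)%:R : R)%:C%C *: e i = 0.
    rewrite (bigD1 j) //= ej0 scaler0 add0r big1 // => i /negbTE ->.
    by rewrite scale0r.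
  by rewrite eqxx => /eqP; rewrite oner_eq0.
have tr2V : \tr (e i2 *m V) = 0.
  by rewrite mulmxBr raddfB /= [X in _ - X]mxtrace_mulC -mulmxA
    [X in _ - X]mxtrace_mulC mulmxA subrr.
have tr3V : \tr (e i3 *m V) = 0.
  by rewrite mulmxBr raddfB /= [X in X - _]mxtrace_mulC -mulmxA
    [X in X - _]mxtrace_mulC mulmxA subrr.
have trq : \tr (e i1 *m V) = - (q%:C%C * \tr (e i3 *m e i3)).
  have c132 : \tr (e i1 *m (e i3 *m e i2)) = \tr (e i2 *m e i1 *m e i3).
    by rewrite mxtrace_mulC -[in LHS]mulmxA mxtrace_mulC.
  rewrite mulmxBr raddfB /= mulmxA c132 -raddfB /= -mulmxBl b12.
  by rewrite mulNmx -scalemxAl raddfN /= mxtraceZ.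
have trp : \tr (e i1 *m V) = p%:C%C * \tr (e i2 *m e i2).
  have c123' : \tr (e i1 *m (e i2 *m e i3)) = \tr (e i3 *m e i1 *m e i2).
    by rewrite mulmxA mxtrace_mulC mulmxA.
  rewrite mulmxBr raddfB /= mulmxA -mulmxA c123' mulmxA -raddfB /= -mulmxBl -opprB.
  by rewrite b13 opprK -scalemxAl mxtraceZ.
have trV : \tr (V *m V) = - \tr (e i1 *m V).
  rewrite {1}/V b23 mulNmx raddfN /= !mulmxDl !mxtraceD -!scalemxAl !mxtraceZ.
  by rewrite tr2V tr3V !mulr0 !addr0.
have [sV sV0 sVE] := su2_trace_sqr R V (su2_bracket R _ _ (eS i2) (eS i3)) V0.
have [s2 s20 s2E] := su2_trace_sqr R (e i2) (eS i2) (e0 i2).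
have [s3 s30 s3E] := su2_trace_sqr R (e i3) (eS i3) (e0 i3).
have qE : sV = q * s3.
  have := congr1 (@complex.Re R) trV; rewrite sVE trq s3E !ReImE; lra.
have pE : sV = - p * s2.
  have := congr1 (@complex.Re R) trV; rewrite sVE trp s2E !ReImE; lra.
have q0 : 0 < q by rewrite -(pmulr_lgt0 _ s30) -qE.
have p0 : p < 0 by rewrite -oppr_gt0 -(pmulr_lgt0 _ s20) -pE.
pose br (x y : 'M[R[i]]_2) := x *m y - y *m x.
have brD x y z : br (x + y) z = br x z + br y z.
  by rewrite /br mulmxDl mulmxDr opprD addrACA.
have brN x z : br (- x) z = - br x z.
  by rewrite /br mulNmx mulmxN opprB opprK addrC.
have brZ k x z : br (k *: x) z = k *: br x z.
  by rewrite /br -scalemxAl -scalemxAr scalerBr.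
have brx x : br x x = 0 by exact: subrr.
have b21 : br (e i2) (e i1) = q%:C%C *: e i3 by rewrite /br -opprB b12 opprK.
have b31 : br (e i3) (e i1) = p%:C%C *: e i2 by rewrite /br -opprB b13 opprK.
have ab : al = 0 /\ be = 0.
  (* The Jacobi identity for the basis reduces to [be * p] e_2 + [al * q] e_3 = 0: the two other
     double brackets are multiples of [e_2, e_2] and [e_3, e_3]. *)
  pose u (i : 'I_3) : R := if i == i1 then 0 else if i == i2 then be * p else al * q.
  have ui : \sum_i (u i)%:C%C *: e i = 0.
    have J : br (br (e i2) (e i3)) (e i1) + br (br (e i3) (e i1)) (e i2)
      + br (br (e i1) (e i2)) (e i3) = 0 := mx2_jacobi _ (e i1) (e i2) (e i3).
    rewrite [br _ (e i3)]b23 b31 [br (e i1) _]b12 !(brN, brD, brZ) b21 b31 !brx in J.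
    rewrite !scaler0 oppr0 !addr0 add0r !scalerA in J.
    rewrite sum3E /u /= scale0r add0r !rmorphM addrC; apply/eqP.
    by rewrite -oppr_eq0 J.
  have := ei u ui i2; have := ei u ui i3; rewrite /u /=.
  by move=> /eqP + /eqP; rewrite !mulf_eq0 (gt_eqF q0) (lt_eqF p0) !orbF => /eqP-> /eqP->.
have [al0 be0] := ab.
exists p, q; split=> //; apply: I3P; apply: I3P; apply: I3P;
  rewrite /unimodular_const /= ?cjj //; try (by rewrite str_const_anti ?c123 ?c112 ?c113
    ?c212 ?c313 ?[str_const _ i2 i2 i3]al0 ?[str_const _ i3 i2 i3]be0 ?oppr0).
Qed.

(** * Torsion *)

(** Twice entries (2,2) and (3,2) are the velocities of a and c; the other two non-zero entries are
    the ones compatible with J^2 = - 1. *)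
Definition torsion_coef {R : realType} (p q a c : R) (i j : 'I_3) : R :=
  match val i, val j with
  | 1%N, 1%N => a * (p * c - q * (1 + a ^+ 2) / c) / 2
  | 2%N, 1%N => (q * (1 - a ^+ 2) + p * c ^+ 2) / 2
  | 1%N, 2%N => (q * (1 + a ^+ 2) ^+ 2 / c ^+ 2 + p * (1 - a ^+ 2)) / 2
  | 2%N, 2%N => - (a * (p * c - q * (1 + a ^+ 2) / c) / 2)
  | _, _ => 0
  end.

(** Rescaling Z_1 rescales theta^1 inversely, so the products of their components, the entries of
    the projection onto T^{1,0}, are determined by J although the factors are not. The eigenvector
    equation fixes the ratio of [z2] to [z3], the annihilation of Z_{\bar 1} the ratio of [t3] to
    [t2], and the duality with Z_1 the remaining scale. *)
Lemma holomorphic_projection (R : realType) (a c : R) (t2 t3 z2 z3 : R[i]) :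
  0 < c ->
  c%:C%C * z2 - a%:C%C * z3 = 'i%C * z3 ->
  t2 * z2 + t3 * z3 = 1 -> t2 * (z2^*)%C + t3 * (z3^*)%C = 0 ->
  [/\ t3 = (- a / c +i* c^-1)%C * t2,
      (z2^*)%C = - (- a / c +i* c^-1)%C * (z3^*)%C
    & [/\ z2 * t2 = (2^-1 -i* (a / 2))%C, z3 * t2 = (0 -i* (c / 2))%C,
      z2 * t3 = (0 +i* ((1 + a ^+ 2) / (2 * c)))%C
    & z3 * t3 = (2^-1 +i* (a / 2))%C]].
Proof.
move=> c0 JZ tZ tZb; have cn0 : c != 0 by rewrite gt_eqF.
have z2E : z2 = (a / c +i* c^-1)%C * z3.
  have cC0 : (c%:C != 0)%C by rewrite eq_complex /= negb_and cn0.
  apply: (mulfI cC0); rewrite mulrA; have -> : (c%:C * (a / c +i* c^-1) = a +i* 1)%C.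
    by apply: complex_ext; rewrite !ReImE; field.
  have -> : (a +i* 1 = a%:C + 'i)%C by cring.
  by rewrite mulrDl -JZ; ring.
have z2bE : (z2^*)%C = - (- a / c +i* c^-1)%C * (z3^*)%C.
  by rewrite z2E; apply: complex_ext; rewrite !ReImE; field.
have z30 : (z3^*)%C != 0.
  rewrite conjc_eq0; apply/eqP => z30; move: tZ; rewrite z2E z30 !mulr0 addr0.
  by move=> /eqP; rewrite eq_sym oner_eq0.
have t3E : t3 = (- a / c +i* c^-1)%C * t2.
  apply/eqP; rewrite -subr_eq0; apply/eqP; apply: (mulIf z30).
  by rewrite mul0r -tZb z2bE; ring.
have z3t2 : z3 * t2 = (0 -i* (c / 2))%C.
  have ic0 : (0 +i* (2 / c) != 0)%C.
    by rewrite eq_complex /= negb_and mulf_neq0 ?invr_eq0 ?orbT // pnatr_eq0.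
  apply: (mulfI ic0); transitivity (1 : R[i]).
    by rewrite -tZ t3E z2E; apply: complex_ext; rewrite !ReImE; field.
  by apply: complex_ext; rewrite !ReImE; field.
split=> //; split=> //.
- by rewrite z2E -mulrA z3t2; apply: complex_ext; rewrite !ReImE; field.
- by rewrite z2E t3E mulrCA -!mulrA z3t2; apply: complex_ext; rewrite !ReImE; field.
- by rewrite t3E mulrCA z3t2; apply: complex_ext; rewrite !ReImE; field.
Qed.

Lemma ext_d_omega1 (R : realType) (M : homogeneous_manifold R) (j k : 'I_3) p :
  ext_d (fun i p => (@omega1 R M i p)%:C%C) j k p = (str_const M i1 j k)%:C%C.
Proof.
have dcst i : cpart i (fun y : M => (@omega1 R M k y)%:C%C) p = 0.
  exact: (cpart_cst R M i (k == i1)%:R%:C%C p).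
have dcst' i : cpart i (fun y : M => (@omega1 R M j y)%:C%C) p = 0.
  exact: (cpart_cst R M i (j == i1)%:R%:C%C p).
by rewrite /ext_d dcst dcst' sum3E /omega1 /= !mulr0 mulr1 !addr0 subrr add0r.
Qed.

(* The torsion coefficient A depends on the choice of Z_1 by a phase, and X_1
   may differentiate that phase; contracting the structure equation with
   Z_{\bar 1} removes the derivative. *)
Lemma torsion_tensorE (R : realType) (M : homogeneous_manifold R) (p q a c : R)
    T Z th1 om A W :
  (forall i j k, str_const M i j k = unimodular_const p q i j k) -> 0 < c ->
  tanaka_webster (@omega1 R M) (fun=> Jabc a c) T Z th1 om A W ->
  forall i j x, torsion_tensor Z th1 A i j x = (torsion_coef p q a c i j)%:C%C.
Proof.
move=> Hc c0 H i j x; have cn0 : c != 0 by rewrite gt_eqF.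
have T1 y : T i1 y = 1.
  have := tw_reeb H y.
  by rewrite /pairing sum3E /omega1 /= mul1r !mul0r !addr0 => -[].
have T2 y : T i2 y = 0.
  have := tw_reeb_d H i3 y; rewrite !sum3E !ext_d_omega1 !Hc /unimodular_const /=.
  by rewrite !mulr0 mulr1 add0r addr0 => -[].
have T3 y : T i3 y = 0.
  have := tw_reeb_d H i2 y; rewrite !sum3E !ext_d_omega1 !Hc /unimodular_const /=.
  by rewrite !mulr0 !add0r rmorphN1 mulrN1 => /eqP; rewrite oppr_eq0 => /eqP[].
have Z1 y : Z i1 y = 0.
  by have := tw_Z_xi H y; rewrite /pairing sum3E /omega1 /= mul1r !mul0r !addr0.
have t1 y : th1 i1 y = 0.
  have := tw_th1_T H y.
  by rewrite /pairing sum3E /tw_T T1 T2 T3 !mulr0 !addr0 mulr1.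
have JZ y : c%:C%C * Z i2 y - a%:C%C * Z i3 y = 'i%C * Z i3 y.
  have := tw_Z_J H i3 y; rewrite /apply_end sum3E Z1 mulr0 add0r => <-.
  rewrite /Jabc !mxE /= !(mulr0, mulr1, addr0, add0r, subr0, sub0r, oppr0).
  by rewrite rmorphN mulNr.
have tZ y : th1 i2 y * Z i2 y + th1 i3 y * Z i3 y = 1.
  by have := tw_th1_Z H y; rewrite /pairing sum3E t1 mul0r add0r.
have tZb y : th1 i2 y * (Z i2 y)^*%C + th1 i3 y * (Z i3 y)^*%C = 0.
  by have := tw_th1_Zbar H y; rewrite /pairing sum3E t1 mul0r add0r.
have [_ _ _ sth _] := tw_smooth H i2.
(* An identity between functions, not only at [x], since it is differentiated along X_1 below. *)
have t3E : th1 i3 = fun y => (- a / c +i* c^-1)%C * th1 i2 y.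
  apply: funext => y.
  by have [] := holomorphic_projection _ _ _ _ _ _ _ c0 (JZ y) (tZ y) (tZb y).
have [t3x z2b [P22 P32 P23 P33]] :=
  holomorphic_projection _ _ _ _ _ _ _ c0 (JZ x) (tZ x) (tZb x).
have dt1 k : cpart k (th1 i1) x = 0.
  have -> : th1 i1 = (fun=> 0) by apply: funext.
  exact: cpart_cst.
have S2 := tw_structure H i1 i2 x.
have S3 := tw_structure H i1 i3 x.
have AE : A x = q%:C%C * th1 i3 x * (Z i2 x)^*%C + p%:C%C * th1 i2 x * (Z i3 x)^*%C.
  have {}S2 : cpart i1 (th1 i2) x + q%:C%C * th1 i3 x =
      - th1 i2 x * om i1 x + A x * (th1 i2 x)^*%C.
    move: S2; rewrite /ext_d /wedge /conj_comp dt1 sum3E !t1 conjc0 !Hc /unimodular_const /=.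
    by rewrite /tw_th /omega1 /= !(mul0r, mulr0, add0r, addr0, subr0, sub0r, mul1r, mulNr).
  have {}S3 : cpart i1 (th1 i3) x + p%:C%C * th1 i2 x =
      - th1 i3 x * om i1 x + A x * (th1 i3 x)^*%C.
    move: S3; rewrite /ext_d /wedge /conj_comp dt1 sum3E !t1 conjc0 !Hc /unimodular_const /=.
    by rewrite /tw_th /omega1 /= !(mul0r, mulr0, add0r, addr0, subr0, sub0r, mul1r, mulNr).
  (* The ratio of the two components is constant, so their X_1-derivatives have the same ratio and
     Z_{\bar 1} annihilates them as it annihilates theta^1. *)
  have D3 : cpart i1 (th1 i3) x = (- a / c +i* c^-1)%C * cpart i1 (th1 i2) x.
    by rewrite t3E cpart_scale.
  have E1 := congr1 (@conjc R) (tZ x); rewrite rmorphD !rmorphM rmorph1 in E1.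
  have E0 := tZb x.
  have : (cpart i1 (th1 i2) x + q%:C%C * th1 i3 x) * (Z i2 x)^*%C +
      (cpart i1 (th1 i3) x + p%:C%C * th1 i2 x) * (Z i3 x)^*%C =
    cpart i1 (th1 i2) x * ((Z i2 x)^*%C + (- a / c +i* c^-1)%C * (Z i3 x)^*%C)
    + (q%:C%C * th1 i3 x * (Z i2 x)^*%C + p%:C%C * th1 i2 x * (Z i3 x)^*%C).
    by rewrite D3; ring.
  have -> : (Z i2 x)^*%C + (- a / c +i* c^-1)%C * (Z i3 x)^*%C = 0.
    by rewrite z2b mulNr addNr.
  rewrite mulr0 add0r => <-; rewrite S2 S3.
  transitivity (- om i1 x * 0 + A x * 1); first by rewrite mulr0 add0r mulr1.
  by rewrite -[in LHS]E0 -[in LHS]E1; ring.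
(* Regrouping pairs each component of Z_1 with one of theta^1, so that only entries of the
   projection remain and the phase cancels. *)
have half : A x * (th1 j x)^*%C * Z i x =
    q%:C%C * (Z i x * th1 i3 x) * (Z i2 x * th1 j x)^*%C
  + p%:C%C * (Z i x * th1 i2 x) * (Z i3 x * th1 j x)^*%C.
  by rewrite AE !rmorphM; ring.
have -> : torsion_tensor Z th1 A i j x =
    A x * (th1 j x)^*%C * Z i x + (A x * (th1 j x)^*%C * Z i x)^*%C.
  by rewrite /torsion_tensor /conj_comp !rmorphM /= conjcK; ring.
rewrite half; move: i j {half}; apply: I3P; apply: I3P;
  rewrite /torsion_coef /= ?Z1 ?t1 ?mulr0 ?mul0r ?conjc0 ?mulr0 ?addr0 ?conjc0 //
    ?P22 ?P32 ?P23 ?P33; by apply: complex_ext; rewrite !ReImE; field.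
Qed.

(** * An explicit Tanaka-Webster structure with constant coefficients *)

Definition vec3 {T : Type} (x y z : T) (i : 'I_3) : T :=
  if i == i1 then x else if i == i2 then y else z.

Lemma ext_d_cst (R : realType) (M : homogeneous_manifold R) (v : 'I_3 -> R[i])
    (j k : 'I_3) (x : M) :
  ext_d (fun i _ => v i) j k x = \sum_i (str_const M i j k)%:C%C * v i.
Proof.
have dcst i l : cpart i (fun _ : M => v l) x = 0 by exact: cpart_cst.
by rewrite /ext_d !dcst subrr add0r.
Qed.

Lemma tanaka_webster_exists (R : realType) (M : homogeneous_manifold R)
    (p q a c : R) :
  (forall i j k, str_const M i j k = unimodular_const p q i j k) -> 0 < c ->
  exists T Z th1 om A (W : R),
    tanaka_webster (@omega1 R M) (fun=> Jabc a c) T Z th1 om A (fun=> W).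
Proof.
move=> Hc c0.
(* The normalization of d theta forces |theta^1_2|^2 = c / 2. The phase is chosen so that theta^1_2
   is positive, equal to 1 / (2 s); with c expressed through s, every check becomes a rational
   identity. *)
pose s := Num.sqrt (2 * c)^-1.
have s0 : s != 0 by rewrite sqrtr_eq0 -ltNge invr_gt0 mulr_gt0.
have s2 : s ^+ 2 = (2 * c)^-1 by rewrite sqr_sqrtr // invr_ge0 mulr_ge0 // ltW.
have cE : c = (2 * s ^+ 2)^-1 by rewrite s2; field; rewrite gt_eqF.
move: cE {c0 s2}; move: (s) s0 => {}s s0 ->.
pose T : 'I_3 -> M -> R := fun i _ => vec3 1 0 0 i.
pose z2 : R[i] := (s +i* - (a * s))%C.
pose z3 : R[i] := (0 +i* - (2 * s)^-1)%C.
pose t2 : R[i] := ((2 * s)^-1 +i* 0)%C.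
pose t3 : R[i] := (- (a * s) +i* s)%C.
(* This is lambda = - p c + q (1 + a^2) / c. The connection form is - (i lambda / 2) omega^1, and
   since d theta = i theta^1 /\ theta^{\bar 1} the Webster curvature is lambda / 2. *)
pose la : R := q * (1 + a ^+ 2) * (2 * s ^+ 2) - p / (2 * s ^+ 2).
pose Z : 'I_3 -> M -> R[i] := fun i _ => vec3 0 z2 z3 i.
pose th1 : 'I_3 -> M -> R[i] := fun i _ => vec3 0 t2 t3 i.
pose om : 'I_3 -> M -> R[i] := fun i _ => vec3 (0 +i* - (la / 2))%C 0 0 i.
pose A : M -> R[i] := fun=> q%:C%C * t3 * (z2^*)%C + p%:C%C * t2 * (z3^*)%C.
exists T, Z, th1, om, A, (la / 2).
split.
- move=> i; split; try exact: csmooth_cst.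
    exact: (csmooth_cst R M (i == i1)%:R%:C%C).
  exact: (csmooth_cst R M (vec3 1 0 0 i)%:C%C).
- by move=> x; rewrite /pairing sum3E /T /omega1 /vec3 /=; cring.
- move=> k x; rewrite sum3E !ext_d_omega1 !Hc /T /vec3 /unimodular_const /=.
  by move: k; apply: I3P => /=; cring.
- by move=> x; rewrite /pairing sum3E /Z /omega1 /vec3 /=; cring.
- apply: I3P => x; rewrite /apply_end sum3E /Z /vec3 /Jabc !mxE /= /z2 /z3;
  by apply: complex_ext; rewrite !ReImE; field.
- by move=> x; rewrite /pairing sum3E /T /th1 /vec3 /=; cring.
- move=> x; rewrite /pairing sum3E /Z /th1 /vec3 /= /z2 /z3 /t2 /t3.
  by apply: complex_ext; rewrite !ReImE; field.
- move=> x; rewrite /pairing sum3E /conj_comp /Z /th1 /vec3 /= /z2 /z3 /t2 /t3.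
  by apply: complex_ext; rewrite !ReImE; field.
- move=> j k x; rewrite ext_d_omega1 Hc /wedge /conj_comp /th1 /unimodular_const.
  by move: j k; apply: I3P; apply: I3P; rewrite /vec3 /= /t2 /t3;
    apply: complex_ext; rewrite !ReImE; field.
- by apply: I3P => x; rewrite /om /vec3 /=; cring.
- move=> j k x; rewrite ext_d_cst sum3E !Hc /wedge /conj_comp /th1 /om /A /unimodular_const /omega1.
  by move: j k; apply: I3P; apply: I3P; rewrite /vec3 /= /t2 /t3 /z2 /z3 /la;
    apply: complex_ext; rewrite !ReImE; field.
- exists (fun _ _ => 0) => j k x.
  rewrite ext_d_cst sum3E !Hc /wedge /conj_comp /th1 /om /unimodular_const.
  by move: j k; apply: I3P; apply: I3P; rewrite /vec3 /= /t2 /t3 /la;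
    apply: complex_ext; rewrite !ReImE; field.
Qed.

(** * The flow as an ordinary differential equation *)

Lemma cvg_shift_dnbhs (R : realType) (x z : R) : (y + z) @[y --> x^'] --> (x + z)^'.
Proof.
move=> P HP.
have H : (y + z) @[y --> x] --> x + z by apply: cvgD; [exact: cvg_id|exact: cvg_cst].
have {}H : \forall y \near x, y + z != x + z -> P (y + z) := H _ HP.
change (\forall y \near x, y != x -> P (y + z)); near=> y => yx.
have : y + z != x + z -> P (y + z) by near: y.
by apply; rewrite (inj_eq (addIr z)).
Unshelve. all: by end_near. Qed.

Lemma is_derive_slope (R : realType) (f : R -> R) (t l : R) :
  is_derive t 1 f l <-> (f s - f t) / (s - t) @[s --> t^'] --> l.
Proof.
split=> [[df <-]|H].
  have sh : (s - t) @[s --> t^'] --> (0 : R)^'.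
    by have := cvg_shift_dnbhs _ t (- t); rewrite subrr.
  have := cvg_comp _ _ sh df; rewrite -/(derive f t 1).
  by move=> K; apply: cvg_trans K; apply: near_eq_cvg; near=> s;
    rewrite /= /GRing.scale /= mulr1 subrK mulrC.
have sh : (h + t) @[h --> (0 : R)^'] --> t^'.
  by have := cvg_shift_dnbhs _ 0 t; rewrite add0r.
have {}H : (fun h => h^-1 *: ((f \o shift t) (h *: 1) - f t)) @ (0 : R)^' --> l.
  have := cvg_comp _ _ sh H.
  by move=> K; apply: cvg_trans K; apply: near_eq_cvg; near=> h;
    rewrite /= /GRing.scale /= mulr1 addrK mulrC.
by apply: DeriveDef; [apply/cvg_ex; exists l|exact: cvg_lim H].
Unshelve. all: by end_near. Qed.

Lemma is_derive_has_derivative_in (R : realType) (I : set R) (f : R -> R) (t l : R) :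
  is_derive t 1 f l -> has_derivative_in I f t l.
Proof.
by move=> /is_derive_slope H; apply: cvg_trans H; apply: cvg_app; apply: cvg_within.
Qed.

Lemma has_derivative_in_is_derive (R : realType) (I : set R) (f : R -> R) (t l : R) :
  nbhs t I -> has_derivative_in I f t l -> is_derive t 1 f l.
Proof.
move=> tI H; apply/is_derive_slope; apply: cvg_trans H; apply: cvg_app => P HP.
have {}HP : \forall s \near t, s != t -> I s -> P s := HP.
change (\forall s \near t, s != t -> P s); near=> s => st.
have Is : I s by near: s.
by move: st Is; near: s.
Unshelve. all: by end_near. Qed.

Lemma has_derivative_in_cvg_right (R : realType) (tau : R) (f : R -> R) (l : R) :
  0 < tau -> has_derivative_in [set t | 0 <= t < tau] f 0 l ->
  f s @[s --> 0^'+] --> f 0.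
Proof.
move=> tau0 H.
have {}H : (f s - f 0) / (s - 0) @[s --> 0^'+] --> l.
  apply: cvg_trans H; apply: cvg_app => P HP.
  have {}HP : \forall s \near (0 : R), s != 0 -> 0 <= s < tau -> P s := HP.
  change (\forall s \near (0 : R), 0 < s -> P s); near=> s => s0.
  have : s != 0 -> 0 <= s < tau -> P s by near: s.
  apply; first by rewrite gt_eqF.
  rewrite (ltW s0) /=; near: s; exact: lt_nbhsl.
have idr : s @[s --> (0 : R)^'+] --> (0 : R) by apply: cvg_at_right_filter; exact: cvg_id.
have E : \forall s \near (0 : R)^'+, (f s - f 0) / (s - 0) * s + f 0 = f s.
  near=> s; have s0 : 0 < s by near: s; exact: nbhs_right_gt.
  by rewrite subr0 divfK ?subrK // gt_eqF.
have K : (f s - f 0) / (s - 0) * s + f 0 @[s --> (0 : R)^'+] --> l * 0 + f 0.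
  by apply: cvgD; [apply: cvgM|exact: cvg_cst].
rewrite mulr0 add0r in K; exact: cvg_trans (near_eq_cvg E) K.
Unshelve. all: by end_near. Qed.

(** Derivatives are asked only off 0, where a flow on [0, tau) is differentiable from one side only;
    right-continuity there suffices for the mean value argument. *)
Lemma nonincreasing_from_right (R : realType) (g dg : R -> R) (t : R) :
  0 < t -> (forall s, 0 < s <= t -> is_derive s 1 g (dg s)) ->
  (forall s, 0 < s <= t -> dg s <= 0) ->
  g s @[s --> 0^'+] --> g 0 -> g t <= g 0.
Proof.
move=> t0 Dg dg0 g0.
have cg s : 0 < s <= t -> {for s, continuous g}.
  by move=> /Dg [+ _] => /derivable1_diffP/differentiable_continuous.
have H : {within `[0, t], continuous g}.
  apply/(continuous_within_itvP _ t0); split=> //.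
    by move=> s; rewrite in_itv /= => /andP[s0 st]; apply: cg; rewrite s0 ltW.
  by apply: cvg_at_left_filter; apply: cg; rewrite t0 lexx.
have D1 s : s \in `]0, t[%R -> derivable g s 1.
  by rewrite in_itv /= => /andP[s0 st]; have [] := Dg s; rewrite ?s0 ?ltW.
have D2 s : s \in `]0, t[%R -> derive1 g s <= 0.
  rewrite in_itv /= => /andP[s0 st]; rewrite derive1E.
  have st' : 0 < s <= t by rewrite s0 ltW.
  by have [_ ->] := Dg s st'; exact: dg0.
by apply: (ler0_derive1_le_cc D1 D2 H); rewrite ?in_itv /= ?lexx ?(ltW t0).
Qed.

Lemma is_derive_mul (R : realType) (f g : R -> R) (t df dg : R) :
  is_derive t 1 f df -> is_derive t 1 g dg ->
  is_derive t 1 (fun s => f s * g s) (df * g t + f t * dg).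
Proof.
move=> Hf Hg; apply: is_derive_eq (is_deriveM Hf Hg) _.
by rewrite /GRing.scale /=; ring.
Qed.

Lemma is_derive_lin (R : realType) (k : R) (f g : R -> R) (t df dg : R) :
  is_derive t 1 f df -> is_derive t 1 g dg ->
  is_derive t 1 (fun s => k * f s + g s) (k * df + dg).
Proof. by move=> Hf Hg; apply: is_deriveD (is_deriveZ k Hf) Hg. Qed.

Lemma is_derive_affine (R : realType) (k m : R) (f : R -> R) (t df : R) :
  is_derive t 1 f df -> is_derive t 1 (fun s => k * f s + m) (k * df).
Proof.
move=> Hf; rewrite -[k * df]addr0.
exact: is_derive_lin _ _ _ _ _ _ _ Hf (is_derive_cst m t 1).
Qed.

Lemma is_derive_div (R : realType) (f g : R -> R) (t df dg : R) :
  g t != 0 -> is_derive t 1 f df -> is_derive t 1 g dg ->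
  is_derive t 1 (fun s => f s / g s) ((df - f t / g t * dg) / g t).
Proof.
move=> g0 Hf Hg; apply: is_derive_eq (is_derive_mul _ _ _ _ _ _ Hf (is_deriveV g0 Hg)) _.
by rewrite /GRing.scale /=; field.
Qed.

(** The solution is cosh (K t) + (l / K) sinh (K t), written with exponentials. Because l / K >= 1,
    it dominates exp (K t) for t >= 0. The third clause is its energy integral, which later
    certifies that the constructed pair solves the flow. *)
Lemma hyperbolic_solution (R : realType) (K l : R) : 0 < K -> K <= l ->
  exists y dy : R -> R,
    [/\ forall t : R, is_derive t 1 y (dy t) /\ is_derive t 1 dy (K ^+ 2 * y t),
        y 0 = 1 /\ dy 0 = l,
        forall t, dy t ^+ 2 - K ^+ 2 * y t ^+ 2 = l ^+ 2 - K ^+ 2,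
        forall t, 0 <= t -> 0 < y t /\ l <= dy t
      & (y t)^-1 @[t --> +oo] --> 0 /\ dy t / y t @[t --> +oo] --> K].
Proof.
move=> K0 Kl; have Kn0 : K != 0 by rewrite gt_eqF.
pose E (t : R) := expR (K * t); pose E' (t : R) := expR (- K * t).
have dexp (k t : R) : is_derive t 1 (fun s : R => expR (k * s)) (k * expR (k * t)).
  have Hk : is_derive t 1 (fun s : R => k * s) k.
    apply: is_derive_eq (is_deriveZ k (is_derive_id t 1)) _.
    by rewrite /GRing.scale /= mulr1.
  by apply: is_derive_eq (is_derive1_comp (is_derive_expR (k * t)) Hk) _; rewrite mulrC.
have EE t : E t * E' t = 1 by rewrite /E /E' mulNr expRxMexpNx_1.
have E0 t : 0 < E t by exact: expR_gt0.
have E'0 t : 0 < E' t by exact: expR_gt0.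
have E1 t : 0 <= t -> 1 <= E t.
  by move=> t0; rewrite /E -expR0 ler_expR mulr_ge0 // ltW.
have E'1 t : 0 <= t -> E' t <= 1.
  by move=> t0; rewrite /E' -expR0 ler_expR mulNr oppr_le0 mulr_ge0 // ltW.
pose m := l / K; have m1 : 1 <= m by rewrite /m ler_pdivlMr // mul1r.
have lE : l = K * m by rewrite /m mulrCA divff // mulr1.
pose y t := (1 + m) / 2 * E t + (1 - m) / 2 * E' t.
pose dy t := K * (1 + m) / 2 * E t + - (K * (1 - m) / 2) * E' t.
have dlin (k k' t : R) : is_derive t 1 (fun s => k * E s + k' * E' s)
    (k * (K * E t) + k' * (- K * E' t)).
  by apply: is_derive_lin.
have yE t : 0 <= t -> E t <= y t.
  by move=> t0; have := E1 t t0; have := E'1 t t0; rewrite /y; nra.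
have E'cvg : E' t @[t --> +oo] --> (0 : R).
  have H : K * t @[t --> +oo] --> +oo by exact: gt0_cvgMry.
  have := cvg_comp _ _ H (@cvgr_expR R).
  by rewrite /E' => H'; under eq_fun do rewrite mulNr.
have vcvg : (y t)^-1 @[t --> +oo] --> (0 : R).
  apply: (@squeeze_cvgr _ _ _ _ (cst 0) E'); [|exact: cvg_cst|exact: E'cvg].
  near=> t; have t0 : 0 <= t by near: t; exact: nbhs_pinfty_ge.
  have y0 := lt_le_trans (E0 t) (yE t t0).
  have -> : E' t = (E t)^-1 by rewrite /E' mulNr expRN.
  by rewrite /= invr_ge0 (ltW y0) /= lef_pV2 ?posrE // yE.
exists y, dy; split.
- move=> t; split; apply: is_derive_eq (dlin _ _ t) _; rewrite /y /dy; ring.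
- by rewrite /y /dy /E /E' !mulr0 expR0 lE; split; field.
- move=> t; have : E t * E' t - 1 = 0 by rewrite EE subrr.
  rewrite lE /y /dy => H; apply/eqP; rewrite -subr_eq0; apply/eqP.
  transitivity (K ^+ 2 * (m ^+ 2 - 1) * (E t * E' t - 1)); last by rewrite H mulr0.
  by field.
- move=> t t0; split; first exact: lt_le_trans (E0 t) (yE t t0).
  rewrite lE /dy -subr_ge0.
  have -> : K * (1 + m) / 2 * E t + - (K * (1 - m) / 2) * E' t - K * m =
    K / 2 * ((E t - E' t) + m * (E t + E' t - 2)) by field.
  apply: mulr_ge0; first by rewrite divr_ge0 // ltW.
  apply: addr_ge0; first by rewrite subr_ge0 (le_trans (E'1 t t0) (E1 t t0)).
  (* [E t] and [E' t] have product 1, so their sum is at least 2. *)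
  apply: mulr_ge0; first exact: le_trans m1.
  by have := EE t; have := E1 t t0; have := E'1 t t0; nra.
split=> //.
(* Since [dy t = K * y t + K * (m - 1) * E' t], the quotient differs from K by a multiple of a
   product of two functions tending to 0. *)
have H : K + K * (m - 1) * (E' t * (y t)^-1) @[t --> +oo] --> K + K * (m - 1) * (0 * 0).
  by apply: cvgD; [exact: cvg_cst|apply: cvgMr; apply: cvgM].
rewrite !mulr0 addr0 in H.
apply: cvg_trans H; apply: near_eq_cvg; near=> t.
have t0 : 0 <= t by near: t; exact: nbhs_pinfty_ge.
have y0 := lt_le_trans (E0 t) (yE t t0).
have -> : dy t = K * y t + K * (m - 1) * E' t by rewrite /dy /y; field.
by field; rewrite gt_eqF.
Unshelve. all: by end_near. Qed.

Lemma JabcE (R : realType) (a c : R) :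
  [/\ Jabc a c i2 i2 = a, Jabc a c i3 i2 = c, Jabc a c i2 i3 = - (1 + a ^+ 2) / c,
      Jabc a c i3 i3 = - a & forall i j, (i == i1) || (j == i1) -> Jabc a c i j = 0].
Proof.
split; last (apply: I3P; apply: I3P => //= _); rewrite /Jabc !mxE /=;
  rewrite !(mulr0, mulr1, addr0, add0r, subr0, sub0r, oppr0) //.
by rewrite mulNr.
Qed.

(* The square of lambda y - y' is nonincreasing and vanishes at 0, as
   (lambda y - y')' = - lambda (lambda y - y') with lambda >= 0. *)
Lemma torsion_flow_unique (R : realType) (p q : R) (tau : R) (a c : R -> R)
    (y dy : R -> R) :
  p < 0 -> 0 < q -> 0 < tau ->
  (forall t, 0 <= t < tau -> 0 < c t /\ forall i j,
    has_derivative_in [set t | 0 <= t < tau] (fun s => Jabc (a s) (c s) i j) t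
      (2 * torsion_coef p q (a t) (c t) i j)) ->
  (forall t : R, is_derive t 1 y (dy t) /\ is_derive t 1 dy (- 4 * p * q * y t)) ->
  y 0 = 1 -> dy 0 = - p * c 0 + q * (1 + a 0 ^+ 2) / c 0 ->
  forall t, 0 <= t < tau ->
    a t * y t = a 0 /\ c t * y t = c 0 + (dy t - dy 0) / (- 2 * p).
Proof.
move=> p0 q0 tau0 Hf Hy y0 dy0.
have pn0 : p != 0 by rewrite lt_eqF.
(* Minus the (2,3) entry of J: its evolution is read off the flow directly, and lambda is linear in
   [c] and [u]. *)
pose u s := (1 + a s ^+ 2) / c s.
pose la s := - p * c s + q * u s.
have JE s := JabcE _ (a s) (c s).
have fa : (fun s => Jabc (a s) (c s) i2 i2) = a by apply: funext => s; have [] := JE s.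
have fc : (fun s => Jabc (a s) (c s) i3 i2) = c by apply: funext => s; have [] := JE s.
have fu : (fun s => -1 * Jabc (a s) (c s) i2 i3 + 0) = u.
  by apply: funext => s; have [_ _ -> _ _] := JE s; rewrite /u; ring.
have c0 s : 0 <= s < tau -> 0 < c s by move=> /Hf[].
have Is s : 0 < s < tau -> nbhs s [set t | 0 <= t < tau].
  move=> /andP[s0 st]; near=> r; apply/andP; split.
    by apply: ltW; near: r; exact: lt_nbhsr.
  by near: r; exact: lt_nbhsl.
have ran s : 0 < s < tau -> 0 <= s < tau by move=> /andP[/ltW -> ->].
have Da s : 0 < s < tau -> is_derive s 1 a (- la s * a s).
  move=> Hs; have [cs /(_ i2 i2)] := Hf s (ran s Hs).
  rewrite fa => /(has_derivative_in_is_derive _ _ _ _ _ (Is s Hs)) H.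
  apply: is_derive_eq H _; rewrite /torsion_coef /la /u /=; field; exact: lt0r_neq0.
have Dc s : 0 < s < tau -> is_derive s 1 c (2 * q - la s * c s).
  move=> Hs; have [cs /(_ i3 i2)] := Hf s (ran s Hs).
  rewrite fc => /(has_derivative_in_is_derive _ _ _ _ _ (Is s Hs)) H.
  apply: is_derive_eq H _; rewrite /torsion_coef /la /u /=; field; exact: lt0r_neq0.
have Du s : 0 < s < tau -> is_derive s 1 u (- 2 * p - la s * u s).
  move=> Hs; have [cs /(_ i2 i3)] := Hf s (ran s Hs).
  move=> /(has_derivative_in_is_derive _ _ _ _ _ (Is s Hs)) H.
  rewrite -fu; apply: is_derive_eq (is_derive_affine _ (-1) 0 _ _ _ H) _.
  have [_ _ -> _ _] := JE s; rewrite /torsion_coef /la /u /=; field; exact: lt0r_neq0.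
have z0 : 0 <= (0 : R) < tau by apply/andP; split; [exact: lexx|].
have [_ H0] := Hf 0 z0.
have ra : a s @[s --> 0^'+] --> a 0.
  by have := has_derivative_in_cvg_right _ _ _ _ tau0 (H0 i2 i2); rewrite fa;
    have [-> _ _ _ _] := JE 0.
have rc : c s @[s --> 0^'+] --> c 0.
  by have := has_derivative_in_cvg_right _ _ _ _ tau0 (H0 i3 i2); rewrite fc;
    have [_ -> _ _ _] := JE 0.
have ru : u s @[s --> 0^'+] --> u 0.
  apply: cvgM; last by apply: cvgV; rewrite ?gt_eqF ?c0.
  by apply: cvgD; [exact: cvg_cst|apply: cvgM].
have right_cont (f df : R -> R) : (forall t : R, is_derive t 1 f (df t)) ->
    f s @[s --> 0^'+] --> f 0.
  move=> Df; apply: cvg_at_right_filter.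
  by have [+ _] := Df 0 => /derivable1_diffP/differentiable_continuous.
have ry := right_cont y dy (fun t => (Hy t).1).
have rdy := right_cont dy _ (fun t => (Hy t).2).
have zero (g dg : R -> R) : (forall s, 0 < s < tau -> is_derive s 1 g (dg s)) ->
    (forall s, 0 < s < tau -> g s * dg s <= 0) ->
    g s @[s --> 0^'+] --> g 0 -> g 0 = 0 -> forall t, 0 <= t < tau -> g t = 0.
  move=> Dg gdg rg g0 t; rewrite le_eqVlt => /andP[/orP[/eqP <- //|t0] tt].
  have lt s : 0 < s <= t -> 0 < s < tau.
    by move=> /andP[-> st]; exact: le_lt_trans tt.
  have : g t * g t <= g 0 * g 0.
    apply: (nonincreasing_from_right _ (fun s => g s * g s)
      (fun s => dg s * g s + g s * dg s)) => //.
    - by move=> s /lt Hs; apply: is_derive_mul; exact: Dg.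
    - by move=> s /lt Hs; rewrite mulrC -mulr2n mulrn_wle0 // gdg.
    - exact: cvgM.
  rewrite g0 mul0r -expr2 => gt0; apply/eqP; rewrite -sqrf_eq0.
  by rewrite eq_le gt0 sqr_ge0.
have h0 : forall t, 0 <= t < tau -> la t * y t - dy t = 0.
  apply: (zero _ (fun s => - la s * (la s * y s - dy s))).
  - move=> s Hs; have [Dy Ddy] := Hy s.
    have Dla : is_derive s 1 la (- 4 * p * q - la s ^+ 2).
      apply: is_derive_eq (is_derive_lin _ (- p) _ _ _ _ _ (Dc s Hs)
        (is_deriveZ q (Du s Hs))) _.
      by rewrite /GRing.scale /= /la; ring.
    apply: is_derive_eq (is_deriveB (is_derive_mul _ _ _ _ _ _ Dla Dy) Ddy) _.
    by ring.
  - move=> s Hs; have la0 : 0 <= la s.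
      have cs := c0 s (ran s Hs); have us : 0 <= u s.
        by rewrite divr_ge0 ?addr_ge0 ?sqr_ge0 // ltW.
      by rewrite addr_ge0 // mulr_ge0 // ?oppr_ge0 ltW.
    rewrite mulrCA mulNr oppr_le0 mulr_ge0 // -expr2; exact: sqr_ge0.
  - apply: cvgB => //; apply: cvgM => //.
    by apply: cvgD; apply: cvgM => //; exact: cvg_cst.
  - by rewrite y0 dy0 /la /u; ring.
move=> t Ht; split; apply/eqP; rewrite -subr_eq0; apply/eqP.
  (* By [h0] the derivative - a (lambda y - y') of a y vanishes; for c y + y' / (2 p) it is - c
     (lambda y - y'). *)
  apply: (zero (fun s => a s * y s - a 0) (fun=> 0)) Ht.
  - move=> s Hs; have [Dy _] := Hy s.
    apply: is_derive_eq (is_deriveB (is_derive_mul _ _ _ _ _ _ (Da s Hs) Dy) (is_derive_cst _ s 1)) _.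
    transitivity (- a s * (la s * y s - dy s)); first by ring.
    by rewrite h0 ?ran // mulr0.
  - by move=> s _; rewrite mulr0.
  - by apply: cvgB; [apply: cvgM|exact: cvg_cst].
  - by rewrite y0; ring.
apply: (zero (fun s => c s * y s - (c 0 + (dy s - dy 0) / (- 2 * p))) (fun=> 0)) Ht.
- move=> s Hs; have [Dy Ddy] := Hy s.
  have DN : is_derive s 1 (fun s => (- 2 * p)^-1 * dy s + (c 0 - (- 2 * p)^-1 * dy 0)) (2 * q * y s).
    apply: is_derive_eq (is_derive_affine _ _ _ _ _ _ Ddy) _.
    by field.
  rewrite (_ : (fun s => _) = (fun s => c s * y s - ((- 2 * p)^-1 * dy s + (c 0 - (- 2 * p)^-1 * dy 0)))).
    apply: is_derive_eq (is_deriveB (is_derive_mul _ _ _ _ _ _ (Dc s Hs) Dy) DN) _.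
    transitivity (- c s * (la s * y s - dy s)); first by ring.
    by rewrite h0 ?ran // mulr0.
  by apply: funext => r; ring.
- by move=> s _; rewrite mulr0.
- apply: cvgB; [exact: cvgM|apply: cvgD; [exact: cvg_cst|]].
  by apply: cvgMl; apply: cvgB => //; exact: cvg_cst.
- by rewrite y0; ring.
Unshelve. all: by end_near. Qed.

Lemma torsion_flow_solution (R : realType) (p q K a0 c0 : R) :
  p < 0 -> 0 < q -> 0 < K -> K ^+ 2 = - 4 * p * q -> 0 < c0 ->
  exists a c : R -> R,
    [/\ a 0 = a0 /\ c 0 = c0,
        forall t, 0 <= t -> 0 < c t /\ forall i j,
          is_derive t 1 (fun s => Jabc (a s) (c s) i j)
            (2 * torsion_coef p q (a t) (c t) i j),
        forall (tau : R) (a' c' : R -> R), 0 < tau -> a' 0 = a0 -> c' 0 = c0 ->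
          (forall t, 0 <= t < tau -> 0 < c' t /\ forall i j,
            has_derivative_in [set t | 0 <= t < tau]
              (fun s => Jabc (a' s) (c' s) i j) t
              (2 * torsion_coef p q (a' t) (c' t) i j)) ->
          forall t, 0 <= t < tau -> a' t = a t /\ c' t = c t
      & a t @[t --> +oo] --> 0 /\ c t @[t --> +oo] --> K / (- 2 * p)].
Proof.
move=> p0 q0 K0 K2 c00; have pn0 : p != 0 by rewrite lt_eqF.
have qn0 : q != 0 by rewrite gt_eqF.
have cn0 : c0 != 0 by rewrite gt_eqF.
pose l := - p * c0 + q * (1 + a0 ^+ 2) / c0.
have l0 : 0 <= l.
  by rewrite addr_ge0 ?divr_ge0 ?mulr_ge0 ?addr_ge0 ?sqr_ge0 ?oppr_ge0 // ltW.
(* Arithmetic-geometric mean: the two summands of [l] have product - p q (1 + a0^2), which is at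
   least K^2 / 4. *)
have Kl : K <= l.
  rewrite -ler_sqr ?nnegrE ?(ltW K0) // -subr_ge0 K2.
  have -> : l ^+ 2 - - 4 * p * q =
      (- p * c0 - q * (1 + a0 ^+ 2) / c0) ^+ 2 + 4 * (- p * q * a0 ^+ 2).
    by rewrite /l; field.
  apply: addr_ge0; first exact: sqr_ge0.
  by apply: mulr_ge0 => //; apply: mulr_ge0; [nra|exact: sqr_ge0].
have [y [dy [Hy [y0 dy0] yK ypos [yoo dyoo]]]] := hyperbolic_solution _ _ _ K0 Kl.
pose N t := c0 + (dy t - dy 0) / (- 2 * p).
have Hy' (t : R) : is_derive t 1 y (dy t) /\ is_derive t 1 dy (- 4 * p * q * y t).
  by rewrite -K2; exact: Hy.
(* These formulas solve the two conservation laws for a and c, so uniqueness leaves no other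
   candidate. *)
exists (fun t => a0 / y t), (fun t => N t / y t); split.
- by rewrite /N subrr mul0r addr0 y0 !divr1.
- move=> t t0; have [yt ldy] := ypos t t0; have [Dy Ddy] := Hy' t.
  have Np : 0 < N t.
    by rewrite ltr_wpDr // dy0 divr_ge0 ?subr_ge0 // mulNr -mulrN mulr_ge0 // oppr_ge0 ltW.
  have Nn0 : N t != 0 by rewrite gt_eqF.
  have yn0 : y t != 0 by rewrite gt_eqF.
  split; first exact: divr_gt0.
  pose a s := a0 / y s; pose c s := N s / y s.
  have ct0 : c t != 0 by rewrite mulf_neq0 ?invr_eq0.
  (* The relation lambda = y' / y for the candidate. Multiplied by [N t] it is quadratic in [y t]
     and [dy t], and follows from the energy integral [yK]. *)
  have la : dy t = y t * (- p * c t + q * (1 + a t ^+ 2) / c t).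
    apply: (mulIf Nn0); have -> : y t * (- p * c t + q * (1 + a t ^+ 2) / c t) * N t =
        - p * N t ^+ 2 + q * (y t ^+ 2 + a0 ^+ 2).
      by rewrite /c /a; field; rewrite yn0 Nn0.
    have -> : y t ^+ 2 = (dy t ^+ 2 - l ^+ 2) / (- 4 * p * q) + 1.
      rewrite -K2; apply: (mulfI (lt0r_neq0 (exprn_gt0 2 K0))).
      have -> : K ^+ 2 * ((dy t ^+ 2 - l ^+ 2) / K ^+ 2 + 1) = dy t ^+ 2 - l ^+ 2 + K ^+ 2.
        by field; rewrite lt0r_neq0.
      by have := yK t; lra.
    by rewrite /N dy0 /l; field; rewrite pn0 qn0.
  have Da : is_derive t 1 a (a t * (p * c t - q * (1 + a t ^+ 2) / c t)).
    apply: is_derive_eq (is_derive_div _ _ _ _ _ _ yn0 (is_derive_cst a0 t 1) Dy) _.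
    by rewrite la -/(a t); field; rewrite ct0.
  have DN : is_derive t 1 N (2 * q * y t).
    have H := is_derive_affine _ (- 2 * p)^-1
      (c0 - (- 2 * p)^-1 * dy 0) _ _ _ Ddy.
    have -> : N = (fun s => (- 2 * p)^-1 * dy s + (c0 - (- 2 * p)^-1 * dy 0)).
      by apply: funext => s; rewrite /N; ring.
    by apply: is_derive_eq H _; field.
  have Dc : is_derive t 1 c (q * (1 - a t ^+ 2) + p * c t ^+ 2).
    apply: is_derive_eq (is_derive_div _ _ _ _ _ _ yn0 DN Dy) _.
    by rewrite -/(c t) la; field; rewrite yn0 ct0.
  have JE s := JabcE _ (a s) (c s).
  move=> i j; have [/orP ij|] := boolP ((i == i1) || (j == i1)).
    have -> : (fun s => Jabc (a s) (c s) i j) = (fun=> 0).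
      by apply: funext => s; have [_ _ _ _ ->] := JE s => //; apply/orP.
    apply: is_derive_eq (is_derive_cst 0 t 1) _.
    by move: i j ij; apply: I3P; apply: I3P => -[] //; rewrite /torsion_coef /= mulr0.
  move: i j; apply: I3P; apply: I3P => // _.
  - have -> : (fun s => Jabc (a s) (c s) i2 i2) = a.
      by apply: funext => s; have [] := JE s.
    by apply: is_derive_eq Da _; rewrite /torsion_coef /= -/(a t) -/(c t); field; rewrite ct0.
  - have -> : (fun s => Jabc (a s) (c s) i2 i3) =
        (fun s => ((-1) * (a s * a s) + -1) / c s).
      by apply: funext => s; have [_ _ -> _ _] := JE s; rewrite expr2; congr (_ / _); ring.
    have D1 := is_derive_affine _ (-1) (-1) _ _ _ (is_derive_mul _ _ _ _ _ _ Da Da).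
    apply: is_derive_eq (is_derive_div _ _ _ _ _ _ ct0 D1 Dc) _.
    by rewrite /torsion_coef /= -/(a t) -/(c t); field; rewrite ct0.
  - have -> : (fun s => Jabc (a s) (c s) i3 i2) = c.
      by apply: funext => s; have [] := JE s.
    by apply: is_derive_eq Dc _; rewrite /torsion_coef /= -/(a t) -/(c t); field.
  have -> : (fun s => Jabc (a s) (c s) i3 i3) = (fun s => -1 * a s + 0).
    by apply: funext => s; have [_ _ _ -> _] := JE s; ring.
  apply: is_derive_eq (is_derive_affine _ (-1) 0 _ _ _ Da) _.
  by rewrite /torsion_coef /= -/(a t) -/(c t); field; rewrite ct0.
- move=> tau a' c' tau0 a'0 c'0 Hf t Ht.
  have dy0' : dy 0 = - p * c' 0 + q * (1 + a' 0 ^+ 2) / c' 0 by rewrite a'0 c'0.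
  have [ay cy] := torsion_flow_unique _ _ _ _ _ _ _ _ p0 q0 tau0 Hf Hy' y0 dy0' _ Ht.
  have yn0 : y t != 0 by rewrite gt_eqF //; case/andP: Ht => /ypos[].
  by rewrite -a'0 -ay /N -c'0 -cy !mulfK.
split.
  by rewrite -[X in _ --> X](mulr0 a0); apply: cvgMr.
have H : (c0 - dy 0 / (- 2 * p)) * (y t)^-1 + (- 2 * p)^-1 * (dy t / y t) @[t --> +oo]
    --> (c0 - dy 0 / (- 2 * p)) * 0 + (- 2 * p)^-1 * K.
  by apply: cvgD; apply: cvgMr.
rewrite mulr0 add0r (mulrC _ K) in H.
have -> : (fun t => N t / y t) = (fun t => (c0 - dy 0 / (- 2 * p)) * (y t)^-1
    + (- 2 * p)^-1 * (dy t / y t)) by apply: funext => t; rewrite /N; ring.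
exact: H.
Qed.

(** * The standard structure of the 3-sphere *)

Lemma mul2E (K : pzRingType) m n (A : 'M[K]_(m, 2)) (B : 'M[K]_(2, n)) i j :
  (A *m B) i j = A i 0 * B 0 j + A i 1 * B 1 j.
Proof. by rewrite mxE sum2E. Qed.

Lemma det2E (K : comPzRingType) (A : 'M[K]_2) :
  \det A = A 0 0 * A 1 1 - A 0 1 * A 1 0.
Proof.
rewrite (expand_det_row _ 0) sum2E /cofactor !det_mx11 !mxE /= expr0 expr1 mul1r.
rewrite mulN1r mulrN; congr (_ * A _ _ - _ * A _ _); exact: val_inj.
Qed.

(** For determinant 1 the inverse is the adjugate, and unitarity equates it with the adjoint. In
    this form SU(2) is the group of unit quaternions, and the first two equations are
    real-linear. *)
Lemma SU2P (R : realType) (g : 'M[R[i]]_2) :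
  SU2 g <-> [/\ g 1 1 = (g 0 0)^*%C, g 0 1 = - (g 1 0)^*%C
    & g 0 0 * (g 0 0)^*%C + g 1 0 * (g 1 0)^*%C = 1].
Proof.
rewrite /SU2 det2E; split=> [[/matrixP gg dg]|[g11 g01 gn]].
  have G i j : g i 0 * (g j 0)^*%C + g i 1 * (g j 1)^*%C = (i == j)%:R.
    by have := gg i j; rewrite mul2E !mxE.
  have G00 := G 0 0; have G01 := G 0 1; have G11 := G 1 1; have G10 := G 1 0.
  rewrite /= in G00 G01 G11 G10.
  have d : g 1 1 = (g 0 0)^*%C.
    transitivity (g 1 1 * (g 0 0 * (g 0 0)^*%C + g 0 1 * (g 0 1)^*%C)).
      by rewrite G00 mulr1.
    transitivity ((g 0 0)^*%C * (g 0 0 * g 1 1 - g 0 1 * g 1 0) +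
      g 0 1 * (g 1 0 * (g 0 0)^*%C + g 1 1 * (g 0 1)^*%C)); first by ring.
    by rewrite dg G10 mulr0 mulr1 addr0.
  have b : g 0 1 = - (g 1 0)^*%C.
    transitivity (g 0 1 * (g 1 0 * (g 1 0)^*%C + g 1 1 * (g 1 1)^*%C)).
      by rewrite G11 mulr1.
    transitivity (- (g 1 0)^*%C * (g 0 0 * g 1 1 - g 0 1 * g 1 0) +
      g 1 1 * (g 0 0 * (g 1 0)^*%C + g 0 1 * (g 1 1)^*%C)); first by ring.
    by rewrite dg G01 mulr0 mulr1 addr0.
  split=> //; transitivity (g 0 0 * (g 0 0)^*%C + g 0 1 * (g 0 1)^*%C); last exact: G00.
  rewrite b; congr (_ + _).
  by rewrite rmorphN /= mulrNN conjcK mulrC.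
split; last by rewrite g11 g01 -gn; ring.
apply/matrixP; apply: I2P; apply: I2P; rewrite mul2E !mxE /= ?g11 ?g01
  ?rmorphN /= ?conjcK -?gn; by ring.
Qed.

Lemma cpart_bracket (R : realType) (M : homogeneous_manifold R) (j k : 'I_3)
    (f : M -> R[i]) (p : M) : csmooth f ->
  cpart j (cpart k f) p - cpart k (cpart j f) p
    = - \sum_i (str_const M i j k)%:C%C * cpart i f p.
Proof.
move=> [sr si]; rewrite sum3E.
have Hr := frame_bracket j k p sr; have Hi := frame_bracket j k p si.
rewrite sum3E in Hr; rewrite sum3E in Hi.
apply: complex_ext; rewrite !ReImE; [rewrite [LHS]Hr | rewrite [LHS]Hi]; ring.
Qed.

(** A matrix of quaternionic shape is determined by its value on one unit vector: this is right
    division by the unit quaternion with first column (v0, v1). *)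
Lemma quaternion_solve (R : realType) (a c v0 v1 w0 w1 : R[i]) :
  v0 * v0^*%C + v1 * v1^*%C = 1 ->
  a * v0 - c^*%C * v1 = w0 -> c * v0 + a^*%C * v1 = w1 ->
  a = w0 * v0^*%C + w1^*%C * v1 /\ c = w1 * v0^*%C - w0^*%C * v1.
Proof.
move=> nv <- <-; split.
  rewrite rmorphD !rmorphM /= conjcK; transitivity (a * (v0 * v0^*%C + v1 * v1^*%C)).
    by rewrite nv mulr1.
  by ring.
rewrite rmorphB !rmorphM /= conjcK; transitivity (c * (v0 * v0^*%C + v1 * v1^*%C)).
  by rewrite nv mulr1.
by ring.
Qed.

(** Here x = g* (g x), and matrices of quaternionic shape are closed under products and adjoints. *)
Lemma quaternion_quotient (R : realType) (g x : 'M[R[i]]_2) : SU2 g ->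
  (g *m x) 1 1 = ((g *m x) 0 0)^*%C -> (g *m x) 0 1 = - ((g *m x) 1 0)^*%C ->
  x 1 1 = (x 0 0)^*%C /\ x 0 1 = - (x 1 0)^*%C.
Proof.
move=> /SU2P[g11 g01 gn]; rewrite !mul2E g11 g01 => Y11 Y01.
have gn' : g 1 0 * (g 1 0)^*%C + (g 0 0)^*%C * (g 0 0)^*%C^*%C = 1.
  by rewrite conjcK -gn; ring.
split.
  transitivity ((g 0 0 * (g 0 0)^*%C + g 1 0 * (g 1 0)^*%C) * x 1 1).
    by rewrite gn mul1r.
  transitivity (- g 1 0 * (g 0 0 * x 0 1 + - (g 1 0)^*%C * x 1 1) +
     g 0 0 * (g 1 0 * x 0 1 + (g 0 0)^*%C * x 1 1)); first by ring.
  rewrite Y01 Y11.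
  rewrite !(rmorphD, rmorphM, rmorphN) /= !conjcK.
  transitivity ((g 0 0 * (g 0 0)^*%C + g 1 0 * (g 1 0)^*%C) * (x 0 0)^*%C).
    by ring.
  by rewrite gn mul1r.
transitivity ((g 0 0 * (g 0 0)^*%C + g 1 0 * (g 1 0)^*%C) * x 0 1).
  by rewrite gn mul1r.
transitivity ((g 0 0)^*%C * (g 0 0 * x 0 1 + - (g 1 0)^*%C * x 1 1) +
   (g 1 0)^*%C * (g 1 0 * x 0 1 + (g 0 0)^*%C * x 1 1)); first by ring.
rewrite Y01 Y11 !(rmorphD, rmorphM, rmorphN) /= !conjcK.
transitivity (- ((g 0 0 * (g 0 0)^*%C + g 1 0 * (g 1 0)^*%C) * (x 1 0)^*%C)).
  by ring.
by rewrite gn mul1r.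
Qed.

Lemma SU2_mulIl (R : realType) (g : 'M[R[i]]_2) m (A B : 'M[R[i]]_(2, m)) :
  SU2 g -> g *m A = g *m B -> A = B.
Proof.
move=> [/mulmx1C gg _] /(congr1 (mulmx (adjoint_mx g))).
by rewrite !mulmxA gg !mul1mx.
Qed.

(** The real-linear equations of [SU2P] pass to the derivatives psi x_i, hence to x_i. Right
    multiplication by a constant matrix commutes with differentiation, so X_j X_k psi = psi x_j x_k,
    and the frame brackets become matrix commutators with the same sign. *)
Lemma left_invariant_frame (R : realType) (M : homogeneous_manifold R)
    (psi : M -> 'M[R[i]]_2) (x : 'I_3 -> 'M[R[i]]_2) :
  (forall j k, csmooth (fun p => psi p j k)) -> (forall p, SU2 (psi p)) ->
  (forall i p j k, cpart i (fun q => psi q j k) p = (psi p *m x i) j k) ->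
  (forall i, x i 1 1 = (x i 0 0)^*%C /\ x i 0 1 = - (x i 1 0)^*%C) /\
  (forall j k, x j *m x k - x k *m x j
     = - \sum_i (str_const M i j k)%:C%C *: x i).
Proof.
move=> sm gSU gx; have [p0 _] := points_inhabited M; split=> [i|j k].
  apply: (quaternion_quotient _ _ _ (gSU p0)); rewrite -!gx.
    rewrite (_ : (fun q => psi q 1 1) = (fun q => (psi q 0 0)^*%C)).
      exact: cpart_conj.
    by apply: funext => q; have /SU2P[] := gSU q.
  rewrite (_ : (fun q => psi q 0 1) = (fun q => -1 * (psi q 1 0)^*%C)).
    rewrite cpart_scale; first by rewrite cpart_conj // mulN1r.
    have [sr si] := sm 1 0; split.
      rewrite (_ : (fun _ => _) = (fun p => complex.Re (psi p 1 0))) //.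
      by apply: funext => q; rewrite ReJ.
    rewrite (_ : (fun _ => _) = (fun p => -1 * complex.Im (psi p 1 0))).
      exact: smooth_scale.
    by apply: funext => q; rewrite ImJ mulN1r.
  by apply: funext => q; rewrite mulN1r; have /SU2P[] := gSU q.
apply: (SU2_mulIl _ _ _ _ _ (gSU p0)); apply/matrixP => a b.
have cc l m : cpart l (cpart m (fun q => psi q a b)) p0
    = (psi p0 *m (x l *m x m)) a b.
  rewrite (_ : cpart m (fun q => psi q a b) =
    (fun p => x m 0 b * psi p a 0 + x m 1 b * psi p a 1)).
    have ss : csmooth (fun p => x m 1 b * psi p a 1).
      rewrite (_ : (fun _ => _) = (fun p => x m 1 b * psi p a 1 + 0)).
        by apply: csmooth_lin (sm _ _) _; exact: csmooth_cst.
      by apply: funext => p; rewrite addr0.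
    rewrite cpart_lin // cpart_scale // !gx mulmxA (mul2E _ _ _ _ (x m)).
    by rewrite mulrC [X in _ + X]mulrC.
  by apply: funext => p; rewrite gx mul2E mulrC [X in _ + X]mulrC.
rewrite mulmxBr mxE [X in _ + X]mxE -!cc cpart_bracket // mulmxN mxE; congr (- _).
rewrite mulmx_sumr summxE; apply: eq_bigr => i _.
by rewrite gx -scalemxAr [RHS]mxE.
Qed.

Lemma csmooth_comb (R : realType) (M : manifold3 R) (z w : R[i]) (f g : M -> R[i]) :
  csmooth f -> csmooth g -> csmooth (fun p => f p * z + g p * w).
Proof.
move=> sf sg.
have sg' : csmooth (fun p => w * g p + 0) by apply: csmooth_lin => //; exact: csmooth_cst.
rewrite (_ : (fun _ => _) = (fun p => z * f p + (w * g p + 0))).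
  exact: csmooth_lin.
by apply: funext => p; ring.
Qed.

Lemma cpart_comb (R : realType) (M : homogeneous_manifold R) (i : 'I_3)
    (z w : R[i]) (f g : M -> R[i]) (p : M) : csmooth f -> csmooth g ->
  cpart i (fun q => f q * z + g q * w) p = cpart i f p * z + cpart i g p * w.
Proof.
move=> sf sg.
have sg' : csmooth (fun p => w * g p + 0) by apply: csmooth_lin => //; exact: csmooth_cst.
rewrite (_ : (fun q => _) = (fun p => z * f p + (w * g p + 0))); last first.
  by apply: funext => q; ring.
rewrite cpart_lin // (cpart_lin _ _ _ _ _ (fun=> 0)) //; last exact: csmooth_cst.
by rewrite cpart_cst; ring.
Qed.

Lemma unit_kernel_vector (R : realType) (z : 'M[R[i]]_2) : \det z = 0 ->
  exists v0 v1 : R[i], [/\ v0 * v0^*%C + v1 * v1^*%C = 1,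
    z 0 0 * v0 + z 0 1 * v1 = 0 & z 1 0 * v0 + z 1 1 * v1 = 0].
Proof.
rewrite -det_tr => /eqP/det0P[v v0 vz].
pose n := complex.Re (v 0 0) ^+ 2 + complex.Im (v 0 0) ^+ 2 +
  (complex.Re (v 0 1) ^+ 2 + complex.Im (v 0 1) ^+ 2).
have n0 : 0 < n.
  rewrite lt_def !addr_ge0 ?sqr_ge0 // andbT; apply: contra v0.
  rewrite !paddr_eq0 ?addr_ge0 ?sqr_ge0 // !sqrf_eq0.
  move=> /andP[/andP[/eqP a /eqP b] /andP[/eqP c /eqP d]].
  by apply/eqP/rowP; apply: I2P; rewrite mxE; apply: complex_ext.
pose s := Num.sqrt n^-1.
have s2 : s ^+ 2 * n = 1 by rewrite sqr_sqrtr ?invr_ge0 ?ltW // mulVf // gt_eqF.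
have ker j : v 0 0 * z j 0 + v 0 1 * z j 1 = 0.
  by have /rowP/(_ j) := vz; rewrite mul2E !mxE.
exists (s%:C%C * v 0 0), (s%:C%C * v 0 1); split.
- by apply: complex_ext; rewrite !ReImE; [rewrite -s2 /n|]; ring.
- by rewrite -[RHS](mulr0 s%:C%C) -(ker 0); ring.
- by rewrite -[RHS](mulr0 s%:C%C) -(ker 1); ring.
Qed.

Lemma SU2_standard_CR (R : realType) (M : homogeneous_manifold R) (p q c : R)
    (psi : M -> 'M[R[i]]_2) :
  (forall i j k, str_const M i j k = unimodular_const p q i j k) ->
  p < 0 -> 0 < q -> 0 < c -> - p * c ^+ 2 = q -> is_SU2 psi ->
  is_standard_CR M (Jabc 0 c).
Proof.
move=> Hc p0 q0 c0 cE [sm psi_inj psi_range [x [gx xind]]].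
have pn0 : p != 0 by rewrite lt_eqF.
have qn0 : q != 0 by rewrite gt_eqF.
have cn0 : c != 0 by rewrite gt_eqF.
have gSU m : SU2 (psi m).
  by suff : [set g | SU2 g] (psi m) by []; rewrite -psi_range; exists m.
have [xq xB] := left_invariant_frame _ _ _ _ sm gSU gx.
have b12 : x i1 *m x i2 - x i2 *m x i1 = - (q%:C%C *: x i3).
  by rewrite xB sum3E !Hc /unimodular_const /= !scale0r !add0r.
have b13 : x i1 *m x i3 - x i3 *m x i1 = - (p%:C%C *: x i2).
  by rewrite xB sum3E !Hc /unimodular_const /= !scale0r [0 + _]add0r;
    congr (- _); exact: addr0.
have b23 : x i2 *m x i3 - x i3 *m x i2 = - x i1.
  by rewrite xB sum3E !Hc /unimodular_const /= !scale0r !addr0 scale1r.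
have trB (A B : 'M[R[i]]_2) : \tr (A *m B - B *m A) = 0.
  by rewrite raddfB /= mxtrace_mulC subrr.
have cplx0 (r : R) : r != 0 -> (r%:C%C : R[i]) != 0.
  by move=> r0; rewrite eq_complex /= negb_and r0.
(* Each x_i is a non-zero multiple of a commutator. *)
have trx : forall i, \tr (x i) = 0.
  apply: I3P; apply/eqP.
  - by have /eqP := congr1 mxtrace b23; rewrite trB raddfN /= eq_sym oppr_eq0.
  - have /eqP := congr1 mxtrace b13; rewrite trB raddfN /= mxtraceZ eq_sym oppr_eq0.
    by rewrite mulf_eq0 (negbTE (cplx0 p pn0)).
  - have /eqP := congr1 mxtrace b12; rewrite trB raddfN /= mxtraceZ eq_sym oppr_eq0.
    by rewrite mulf_eq0 (negbTE (cplx0 q qn0)).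
have Rx i : complex.Re (x i 0 0) = 0.
  have := congr1 (@complex.Re R) (trx i); rewrite /mxtrace sum2E (xq i).1 !ReImE; lra.
pose zb := x i2 + (0 +i* c)%C *: x i3.
(* The relation - p c^2 = q is what makes [zb], which represents X_2 + i J X_2, an eigenvector of ad
   x_1; the eigenvalue is non-zero. *)
have zbE : x i1 *m zb - zb *m x i1 = (0 +i* (- c * p))%C *: zb.
  rewrite /zb mulmxDr mulmxDl -scalemxAr -scalemxAl opprD addrACA -scalerBr b12 b13.
  apply/matrixP => a b; rewrite !mxE -cE; cring.
have mu0 : (0 +i* (- c * p) != 0)%C.
  by rewrite eq_complex /= negb_and mulf_neq0 ?oppr_eq0 ?orbT.
(* The eigenvalue times tr (zb zb) is tr ([x_1, zb] zb), which vanishes by cyclicity. Together with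
   tr zb = 0 this makes [zb] nilpotent. *)
have trzz : \tr (zb *m zb) = 0.
  apply: (mulfI mu0); rewrite mulr0 -mxtraceZ scalemxAl -zbE mulmxBl raddfB /=.
  by rewrite [X in _ - X]mxtrace_mulC mulmxA [X in _ - X]mxtrace_mulC mulmxA subrr.
have trz : \tr zb = 0 by rewrite /zb mxtraceD mxtraceZ !trx mulr0 addr0.
have detz : \det zb = 0.
  have z11 : zb 1 1 = - zb 0 0.
    by move: trz; rewrite /mxtrace sum2E addrC => /eqP; rewrite addr_eq0 => /eqP.
  move: trzz; rewrite /mxtrace sum2E !mul2E det2E z11 => H.
  apply: (mulfI (_ : (2 : R[i]) != 0)); first by rewrite pnatr_eq0.
  by rewrite mulr0 -[RHS]oppr0 -H; ring.
have [v0 [v1 [nv kz0 kz1]]] := unit_kernel_vector _ _ detz.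
(* The differential of g v along X_2 + i J X_2 is g zb v = 0, which is the Cauchy-Riemann equation
   for F. *)
pose F m := (psi m 0 0 * v0 + psi m 0 1 * v1, psi m 1 0 * v0 + psi m 1 1 * v1).
have gq m : [/\ psi m 1 1 = (psi m 0 0)^*%C, psi m 0 1 = - (psi m 1 0)^*%C
    & psi m 0 0 * (psi m 0 0)^*%C + psi m 1 0 * (psi m 1 0)^*%C = 1].
  exact/SU2P.
pose X (u : 'cV[R]_3) : 'M[R[i]]_2 := \sum_i (u i 0)%:C%C *: x i.
have XE u a b : X u a b = (u i1 0)%:C%C * x i1 a b + (u i2 0)%:C%C * x i2 a b
    + (u i3 0)%:C%C * x i3 a b by rewrite /X sum3E !mxE.
have Xq u : [/\ X u 1 1 = (X u 0 0)^*%C, X u 0 1 = - (X u 1 0)^*%C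
    & complex.Re (X u 0 0) = 0].
  rewrite !XE !(xq _).1 !(xq _).2; split; [cring|cring|].
  by rewrite !ReImE !Rx; ring.
pose Y u : R[i] * R[i] := (X u 0 0 * v0 + X u 0 1 * v1, X u 1 0 * v0 + X u 1 1 * v1).
have [xv xvE] : exists xv, forall i a, xv i a = x i a 0 * v0 + x i a 1 * v1.
  by exists (fun i a => x i a 0 * v0 + x i a 1 * v1).
have Xv u a : X u a 0 * v0 + X u a 1 * v1 =
    (u i1 0)%:C%C * xv i1 a + (u i2 0)%:C%C * xv i2 a + (u i3 0)%:C%C * xv i3 a.
  by rewrite !XE !xvE; ring.
have cF i m a : cpart i (fun q => psi q a 0 * v0 + psi q a 1 * v1) m =
    psi m a 0 * xv i 0 + psi m a 1 * xv i 1.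
  by rewrite cpart_comb // !gx !mul2E !xvE; ring.
have dF m u : differential F m u =
    (psi m 0 0 * (Y u).1 + psi m 0 1 * (Y u).2, psi m 1 0 * (Y u).1 + psi m 1 1 * (Y u).2).
  rewrite /differential !sum3E !(cF _ _ 0) !(cF _ _ 1).
  rewrite [(Y u).1](Xv u 0) [(Y u).2](Xv u 1).
  by congr pair; ring.
(* As g is unitary, Re <g X v, g v> = Re <X v, v>, which vanishes for an anti-Hermitian X. *)
have real_tangent m u : tangent_S3 (F m) (differential F m u).
  have [g11 g01 gn] := gq m; have [X11 X01 X00] := Xq u.
  rewrite /tangent_S3 dF.
  have -> : (psi m 0 0 * (Y u).1 + psi m 0 1 * (Y u).2) * (F m).1^*%C +
      (psi m 1 0 * (Y u).1 + psi m 1 1 * (Y u).2) * (F m).2^*%C =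
      (psi m 0 0 * (psi m 0 0)^*%C + psi m 1 0 * (psi m 1 0)^*%C) *
      ((Y u).1 * v0^*%C + (Y u).2 * v1^*%C).
    by rewrite /F /= g11 g01 !(rmorphD, rmorphM, rmorphN) /= !conjcK; ring.
  by rewrite gn mul1r /Y /= X11 X01 !ReImE X00; ring.
have dFJ m (u : 'cV[R]_3) : u i1 0 = 0 -> differential F m (Jabc 0 c *m u) =
    ('i%C * (differential F m u).1, 'i%C * (differential F m u).2).
  move=> u1.
  have [J22 J32 J23 J33 J0] := JabcE _ 0 c.
  have Ju1 : (Jabc 0 c *m u) i1 0 = 0 by rewrite mxE sum3E !J0 // !mul0r !addr0.
  have Ju2 : (Jabc 0 c *m u) i2 0 = - c^-1 * u i3 0.
    by rewrite mxE sum3E J22 J23 u1; field.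
  have Ju3 : (Jabc 0 c *m u) i3 0 = c * u i2 0.
    by rewrite mxE sum3E J32 J33 u1; ring.
  have x2v a : xv i2 a = (0 -i* c)%C * xv i3 a.
    have kz : zb a 0 * v0 + zb a 1 * v1 = 0 by move: a; apply: I2P.
    apply/eqP; rewrite -subr_eq0 -kz /zb !mxE !xvE; apply/eqP.
    have -> : (0 -i* c)%C = - (0 +i* c)%C :> R[i] by cring.
    by ring.
  have YJ a : X (Jabc 0 c *m u) a 0 * v0 + X (Jabc 0 c *m u) a 1 * v1 =
      'i%C * (X u a 0 * v0 + X u a 1 * v1).
    rewrite !Xv Ju1 Ju2 Ju3 u1 !x2v !mul0r !add0r !mulrA -mulrDl.
    rewrite ['i%C * _]mulrDr !mulrA -mulrDl; congr (_ * _).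
    by apply: complex_ext; rewrite !ReImE; field.
  by rewrite !dF /Y /= !YJ; congr pair; ring.
exists F; split.
- by split; exact: csmooth_comb.
- split.
    move=> m m' /=; rewrite /F => -[E0 E1]; apply: psi_inj.
    have [g11 g01 _] := gq m; have [h11 h01 _] := gq m'.
    have H k : psi k 0 0 * v0 - (psi k 1 0)^*%C * v1 = (F k).1.
      by rewrite /F /=; have [_ -> _] := gq k; rewrite mulNr.
    have H' k : psi k 1 0 * v0 + (psi k 0 0)^*%C * v1 = (F k).2.
      by rewrite /F /=; have [-> _ _] := gq k.
    have [a1 c1] := quaternion_solve _ _ _ _ _ _ _ nv (H m) (H' m).
    have [a2 c2] := quaternion_solve _ _ _ _ _ _ _ nv (H m') (H' m').
    have FF : F m = F m' by rewrite /F E0 E1.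
    have e00 : psi m 0 0 = psi m' 0 0 by rewrite a1 a2 FF.
    have e10 : psi m 1 0 = psi m' 1 0 by rewrite c1 c2 FF.
    by apply/matrixP; apply: I2P; apply: I2P; rewrite ?g11 ?g01 ?h11 ?h01 ?e00 ?e10.
  apply/seteqP; split=> [_ [m _ <-]|[w0 w1]] /=.
    have [g11 g01 gn] := gq m; rewrite /S3 /F /= g11 g01 -[RHS]nv -[RHS]mul1r -gn.
    by rewrite !(rmorphD, rmorphM, rmorphN) /= !conjcK; ring.
  rewrite /S3 /= => nw.
  (* The quaternion sending v to w, as given by [quaternion_solve]. *)
  pose g : 'M[R[i]]_2 := \matrix_(i, j)
    if i == 0 then if j == 0 then w0 * v0^*%C + w1^*%C * v1
      else - (w1 * v0^*%C - w0^*%C * v1)^*%C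
    else if j == 0 then w1 * v0^*%C - w0^*%C * v1
      else (w0 * v0^*%C + w1^*%C * v1)^*%C.
  have gS : SU2 g.
    apply/SU2P; rewrite !mxE /=; split=> //.
    rewrite !(rmorphB, rmorphD, rmorphM) /= !conjcK.
    transitivity ((w0 * w0^*%C + w1 * w1^*%C) * (v0 * v0^*%C + v1 * v1^*%C)).
      by ring.
    by rewrite nw nv mulr1.
  have : range psi g by rewrite psi_range.
  move=> [m _ mg]; exists m => //; rewrite /F mg !mxE /=.
  rewrite !(rmorphB, rmorphD, rmorphM) /= !conjcK.
  congr pair.
    by rewrite -[RHS]mulr1 -nv; ring.
  by rewrite -[RHS]mulr1 -nv; ring.
- move=> m u; rewrite dF => -[E0 E1].
  have [X11 X01 _] := Xq u.
  have gY : psi m *m (\col_i if i == 0 then (Y u).1 else (Y u).2) = psi m *m 0.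
    rewrite mulmx0; apply/matrixP => a b; rewrite mul2E !mxE /=.
    by move: a; apply: I2P.
  have /matrixP Y0 := SU2_mulIl _ _ _ _ _ (gSU m) gY.
  have := Y0 0 0; have := Y0 1 0; rewrite !mxE /= X11 X01 mulNr => Y1 Y00.
  have [Xa Xc] := quaternion_solve _ _ _ _ _ _ _ nv Y00 Y1.
  have X0 : X u = 0.
    rewrite conjc0 !mul0r subr0 addr0 in Xa Xc.
    by apply/matrixP; apply: I2P; apply: I2P; rewrite ?X11 ?X01 ?Xa ?Xc mxE ?conjc0 ?oppr0.
  by apply/matrixP => i j; rewrite ord1 mxE; exact: (xind (fun i => u i 0) X0).
(* Since i dF(u) = dF(J u), the second tangency condition is the first one for J u. *)
move=> m u u1 v; split; last exact: dFJ.
by split; [exact: real_tangent|rewrite -dFJ //; exact: real_tangent].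
Qed.

(** * The torsion-free structure as limit of the flow and as standard structure on SU(2) *)

Theorem theorem1p1 (R : realType) (M : homogeneous_manifold R)
    (Hadapted : adapted M) (Hsu2 : lie_algebra_iso_su2 M) :
  exists ainf cinf : R,
    [/\ 0 < cinf /\ torsion_free (@omega1 R M) (fun=> Jabc ainf cinf),
        forall a c : R, 0 < c -> torsion_free (@omega1 R M) (fun=> Jabc a c) ->
          a = ainf /\ c = cinf,
        forall a0 c0 : R, 0 < c0 ->
          exists a c : R -> R,
            [/\ a 0 = a0 /\ c 0 = c0,
                normalized_torsion_flow M [set t | 0 <= t] a c,
                forall (tau : R) (a' c' : R -> R), 0 < tau ->
                  a' 0 = a0 -> c' 0 = c0 ->
                  normalized_torsion_flow M [set t | 0 <= t < tau] a' c' ->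
                  forall t, 0 <= t < tau -> a' t = a t /\ c' t = c t
              & a t @[t --> +oo] --> ainf /\ c t @[t --> +oo] --> cinf]
      & forall psi : M -> 'M[R[i]]_2, is_SU2 psi ->
          is_standard_CR M (Jabc ainf cinf)].
Proof.
have [p [q [p0 q0 Hc]]] := adapted_su2_const _ _ Hadapted Hsu2.
have pn0 : p != 0 by rewrite lt_eqF.
have pq0 : 0 < - p * q by rewrite mulr_gt0 // oppr_gt0.
have [pt _] := points_inhabited M.
pose K := 2 * Num.sqrt (- p * q).
have K0 : 0 < K by rewrite mulr_gt0 // sqrtr_gt0.
have K2 : K ^+ 2 = - 4 * p * q.
  by rewrite exprMn sqr_sqrtr ?(ltW pq0) //; ring.
(* This equals sqrt (- q / p), the positive root of p c^2 + q = 0. *)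
pose c1 := K / (- 2 * p).
have c10 : 0 < c1 by rewrite divr_gt0 // mulNr -mulrN mulr_gt0 // oppr_gt0.
have c12 : - p * c1 ^+ 2 = q.
  by rewrite /c1 expr_div_n K2; field.
exists 0, c1; split.
- split=> //; have [T [Z [th1 [om [A [W H]]]]]] := tanaka_webster_exists _ _ _ _ 0 _ Hc c10.
  exists T, Z, th1, om, A, (fun=> W); split=> // i j x.
  rewrite (torsion_tensorE _ _ _ _ _ _ _ _ _ _ _ _ Hc c10 H).
  have cn0 : c1 != 0 by rewrite gt_eqF.
  rewrite -c12; move: i j; apply: I3P; apply: I3P; rewrite /torsion_coef /= ?rmorph0 //;
    by apply: complex_ext; rewrite !ReImE; field.
- move=> a c c0 [T [Z [th1 [om [A [W [H tf]]]]]]].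
  have E i j : torsion_coef p q a c i j = 0.
    have := tf i j pt; rewrite (torsion_tensorE _ _ _ _ _ _ _ _ _ _ _ _ Hc c0 H).
    by move=> /(congr1 (@complex.Re R)).
  (* Entry (2,2) of the torsion is a times this negative quantity, which forces a = 0; entry (3,2)
     then determines c^2. *)
  have neg : p * c - q * (1 + a ^+ 2) / c < 0.
    rewrite subr_lt0; apply: (@lt_trans _ _ 0); first by rewrite nmulr_rlt0.
    by rewrite divr_gt0 // mulr_gt0 // ltr_wpDr // sqr_ge0.
  have a0 : a = 0.
    have /eqP := E i2 i2; rewrite /torsion_coef /= !mulf_eq0 invr_eq0 pnatr_eq0 orbF.
    by rewrite (lt_eqF neg) orbF => /eqP.
  split=> //; have := E i3 i2; rewrite /torsion_coef /= a0 => E32.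
  have cc : c ^+ 2 = c1 ^+ 2.
    by apply: (mulfI pn0); lra.
  by apply/eqP; rewrite -(eqrXn2 (n := 2)) ?cc ?ltW.
- move=> a0 c0 c00.
  have [a [c [ac0 Hf Hu Hl]]] := torsion_flow_solution _ _ _ _ a0 _ p0 q0 K0 K2 c00.
  exists a, c; split=> //.
    move=> t t0; have [ct D] := Hf t t0; split=> //.
    have [T [Z [th1 [om [A [W H]]]]]] := tanaka_webster_exists _ _ _ _ (a t) _ Hc ct.
    exists T, Z, th1, om, A, (fun=> W); split=> //; last by exists W.
    move=> i j x; exists (2 * torsion_coef p q (a t) (c t) i j).
      exact: is_derive_has_derivative_in (D i j).
    by rewrite (torsion_tensorE _ _ _ _ _ _ _ _ _ _ _ _ Hc ct H); cring.
  move=> tau a' c' tau0 a'0 c'0 Hf'; apply: Hu => // t Ht.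
  (* The frame realizing the flow may change with t, but the torsion tensor does not depend on it,
     so the explicit ODE holds. *)
  have [ct [T [Z [th1 [om [A [W [H D _]]]]]]]] := Hf' t Ht; split=> // i j.
  have [l Dl lE] := D i j pt.
  suff <- : l = 2 * torsion_coef p q (a' t) (c' t) i j by [].
  move: lE; rewrite (torsion_tensorE _ _ _ _ _ _ _ _ _ _ _ _ Hc ct H).
  by move=> /(congr1 (@complex.Re R)); rewrite !ReImE => ->; ring.
move=> psi; exact: (SU2_standard_CR _ _ _ _ _ _ Hc p0 q0 c10 c12).
Qed.
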